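(* For every index $\boldsymbol{k}$, we have $\zeta^{\star,\mathrm{sh}}(\boldsymbol{k})\equiv \zeta^{\star,KY}(\boldsymbol{k}) \pmod{\zeta(2)\mathcal{Z}}$.
   Context: An index is a tuple $\boldsymbol{k}=(k_1,\dots,k_r)$ of positive integers ($r\ge 0$; $r=0$ gives the empty index $\varnothing$). It is admissible if it is empty or $k_r\ge 2$. For admissible $\boldsymbol{k}$, $\zeta(k_1,\dots,k_r)=\sum_{1\le n_1<\cdots<n_r}\frac{1}{n_1^{k_1}\cdots n_r^{k_r}}$, $\zeta(\varnothing)=1$. $\mathcal{Z}\subset\mathbb{R}$ is the $\mathbb{Q}$-linear span of $1$ and all multiple zeta values; it is a $\mathbb{Q}$-algebra. Let $\mathfrak{H}=\mathbb{Q}\langle x,y\rangle$, $\mathfrak{H}^1=\mathbb{Q}+y\mathfrak{H}\supset\mathfrak{H}^0=\mathbb{Q}+y\mathfrak{H}x$, $z_k=yx^{k-1}$, $z_{\boldsymbol{k}}=z_{k_1}\cdots z_{k_r}$. Let $Z:\mathfrak{H}^0\to\mathbb{R}$ be the $\mathbb{Q}$-linear map with $Z(z_{\boldsymbol{k}})=\zeta(\boldsymbol{k})$ for admissible $\boldsymbol{k}$ (so $Z(1)=1$). The shuffle product $\mathrm{sh}$ on $\mathfrak{H}$ is the $\mathbb{Q}$-bilinear product with $w\,\mathrm{sh}\,1=1\,\mathrm{sh}\,w=w$ and $w_1u_1\,\mathrm{sh}\,w_2u_2=(w_1\,\mathrm{sh}\,w_2u_2)u_1+(w_1u_1\,\mathrm{sh}\,w_2)u_2$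 for $u_1,u_2\in\{x,y\}$. Then $Z$ is a homomorphism for $\mathrm{sh}$ on $\mathfrak{H}^0$, $(\mathfrak{H}^1,\mathrm{sh})\cong(\mathfrak{H}^0,\mathrm{sh})[y]$, and $Z^{\mathrm{sh}}:(\mathfrak{H}^1,\mathrm{sh})\to\mathbb{R}[T]$, $w\mapsto Z^{\mathrm{sh}}(w;T)$, is the unique $\mathbb{Q}$-algebra homomorphism extending $Z$ with $Z^{\mathrm{sh}}(y;T)=T$; its image lies in $\mathcal{Z}[T]$. Put $\zeta^{\mathrm{sh}}(\boldsymbol{k})=Z^{\mathrm{sh}}(z_{\boldsymbol{k}};0)$ and $$\zeta^{\star,\mathrm{sh}}(k_1,\dots,k_r)=\sum_{\square=\text{`,' or `+'}}\zeta^{\mathrm{sh}}(k_1\square\cdots\square k_r),$$ the sum being over all $2^{r-1}$ ways to replace each $\square$ by a comma or a plus sign (and $\zeta^{\star,\mathrm{sh}}(\varnothing)=1$). Kaneko–Yamamoto regularization: a 2-poset is a finite poset $X$ with a label map $\delta_X:X\to\{x,y\}$. Put $W(X)=\sum_f \delta_X(f^{-1}(1))\cdots\delta_X(f^{-1}(\#X))\in\mathfrak{H}$, summed over all bijections $f:X\to\{1,\dots,\#X\}$ such that $p<q$ implies $f(p)<f(q)$ ($W(\varnothing)=1$). For $\boldsymbol{k}=(k_1,\dots,k_r)$, let $X^\star(\boldsymbol{k})$ be the 2-poset with elements $p_{i,m}$ ($1\le i\le r$, $1\le m\le k_i$), with order generated by $p_{i,1}<p_{i,2}<\cdots<p_{i,k_i}$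 for each $i$ and $p_{i,1}<p_{i+1,k_{i+1}}$ for $1\le i\le r-1$, and with $p_{i,1}$ labelled $y$ and $p_{i,m}$ ($m\ge2$) labelled $x$. Put $w^\star(\boldsymbol{k})=W(X^\star(\boldsymbol{k}))\in\mathfrak{H}^1$ and $\zeta^{\star,KY}(\boldsymbol{k})=Z^{\mathrm{sh}}(w^\star(\boldsymbol{k});0)\in\mathcal{Z}$. *)

(* Defs.v *)
From HB Require Import structures.
From mathcomp Require Import all_boot all_order all_algebra.
From mathcomp Require Import finmap monalg.
From mathcomp Require Import boolp classical_sets reals ereal esum.

Set Implicit Arguments.
Unset Strict Implicit.
Unset Printing Implicit Defensive.

Import Order.TTheory GRing.Theory Num.Theory.

Local Open Scope classical_set_scope.
Local Open Scope ring_scope.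

(* Entries of an index are listed in the order k_1, ..., k_r. *)
Definition is_index (k : seq nat) : bool := all (fun a => 0 < a)%N k.

Definition admissible (k : seq nat) : bool :=
  is_index k && ((k == [::]) || (1 < last 0 k)%N).

Section MultipleZetaValues.
Variable R : realType.

(* [path ltn 0 n] says 0 < n_1 < ... < n_r.  The sum of nonnegative terms is
   taken in the extended reals; it is finite when k is admissible, which is the
   only case in which [zeta k] is meaningful. *)
Definition zeta (k : seq nat) : R :=
  fine (\esum_(n in [set n : (size k).-tuple nat | path ltn 0%N n])
          (\prod_(i < size k) (tnth n i)%:R ^- nth 0%N k i)%:E).

(* The Q-linear span of the multiple zeta values; 1 is [zeta [::]]. *)
Definition mzv_span : set R :=
  [set c | exists2 s : seq (rat * seq nat),
     all (fun p => admissible p.2) s &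
     c = \sum_(p <- s) ratr p.1 * zeta p.2].

End MultipleZetaValues.

Notation letter := bool.
Definition lx : letter := false.
Definition ly : letter := true.

(* Noncommutative polynomials over Q in the two letters: the Q-algebra of the
   free monoid on [letter]. *)
Notation hoffman := {malg rat[{fmonom letter}]}.

Definition word (w : seq letter) : hoffman := << FMonom w >>.

Notation hx := (word [:: lx]).
Notation hy := (word [:: ly]).

Definition H1 : set hoffman := [set h | exists q : rat, exists g : hoffman,
  h = q%:A + hy * g].

Definition H0 : set hoffman := [set h | exists q : rat, exists g : hoffman,
  h = q%:A + hy * g * hx].

Definition zmon (k : seq nat) : hoffman := \prod_(a <- k) (hy * hx ^+ a.-1).

(* Inverse of k |-> z_k on words that are empty or start with y: each y is
   replaced by 1 + the number of x's that directly follow it. *)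
Fixpoint word_index (w : seq letter) : seq nat :=
  match w with
  | [::] => [::]
  | true :: w' => (index ly w').+1 :: word_index w'
  | false :: w' => word_index w'
  end.

(* The linear map Z, given by its values on words; only its restriction to
   [H0] is meaningful. *)
Definition Zmap (R : realType) : hoffman -> R :=
  mmap (@ratr R) (fun w : {fmonom letter} => zeta R (word_index w)).

Lemma word_nil : word [::] = 1.
Proof. by congr << _ >>; apply/eqP; rewrite fmP fm1. Qed.

Lemma word_cat v w : word (v ++ w) = word v * word w.
Proof.
rewrite malgM_def fgmulUU mulr1; congr << _ >>.
by apply/eqP; rewrite fmP fmM.
Qed.

Lemma wordX u n : word [:: u] ^+ n = word (nseq n u).
Proof.
elim: n => [|n IHn]; first by rewrite word_nil.
by rewrite exprS IHn -word_cat.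
Qed.

Lemma zmonE k :
  zmon k = word (flatten [seq ly :: nseq a.-1 lx | a <- k]).
Proof.
elim: k => [|a k IHk]; rewrite /zmon ?big_nil ?word_nil // big_cons [X in _ * X]IHk.
by rewrite wordX -!word_cat.
Qed.

Lemma word_indexK k : is_index k ->
  word_index (flatten [seq ly :: nseq a.-1 lx | a <- k]) = k.
Proof.
elim: k => [|[|a] k IHk] //= /IHk{}IHk; congr cons; last first.
  by rewrite -[RHS]IHk; elim: a.
congr S; elim: a => [|a /= -> //]; by case: k {IHk} => [|b k].
Qed.

Lemma Zmap_zmon (R : realType) k : is_index k -> Zmap R (zmon k) = zeta R k.
Proof.
move=> k_gt0; rewrite zmonE /Zmap mmapU.
have r1 : ratr (1 : rat) = 1 :> R by exact: rmorph1.
by rewrite [X in X * _]r1 mul1r word_indexK.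
Qed.

(* The recursion peels off last letters, so words are passed reversed. *)
Fixpoint shuffle_rev (v1 : seq letter) : seq letter -> hoffman :=
  if v1 is u1 :: w1 then
    fix shuffle_rev_u1w1 (v2 : seq letter) : hoffman :=
      if v2 is u2 :: w2 then
        shuffle_rev w1 v2 * word [:: u1] + shuffle_rev_u1w1 w2 * word [:: u2]
      else word (rev v1)
  else fun v2 => word (rev v2).

Definition shuffle_word (v1 v2 : seq letter) : hoffman :=
  shuffle_rev (rev v1) (rev v2).

Definition shuffle (g h : hoffman) : hoffman :=
  \sum_(v1 <- msupp g) \sum_(v2 <- msupp h)
    (g@_v1 * h@_v2) *: shuffle_word v1 v2.

Lemma shuffle_word_nill v : shuffle_word [::] v = word v.
Proof. by rewrite /shuffle_word /= revK. Qed.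

Lemma shuffle_word_nilr v : shuffle_word v [::] = word v.
Proof.
rewrite /shuffle_word -{2}[v]revK.
by case: (rev v).
Qed.

Lemma shuffle_word_rcons v1 u1 v2 u2 :
  shuffle_word (rcons v1 u1) (rcons v2 u2) =
    shuffle_word v1 (rcons v2 u2) * word [:: u1]
    + shuffle_word (rcons v1 u1) v2 * word [:: u2].
Proof. by rewrite /shuffle_word !rev_rcons. Qed.

Lemma shuffleE v1 v2 : shuffle (word v1) (word v2) = shuffle_word v1 v2.
Proof.
by rewrite /shuffle !msuppU1 !big_seq_fset1 !mcoeffUU mulr1 scale1r.
Qed.

Lemma shuffleEw (d1 d2 : {fset {fmonom letter}}) g h :
    (msupp g `<=` d1)%fset -> (msupp h `<=` d2)%fset ->
  shuffle g h = \sum_(v1 <- d1) \sum_(v2 <- d2)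
    (g@_v1 * h@_v2) *: shuffle_word v1 v2.
Proof.
move=> gd hd; rewrite /shuffle (big_fset_incl _ gd) /=; last first.
  move=> v _ /mcoeff_outdom ->.
  by rewrite big1 // => w _; rewrite mul0r scale0r.
apply: eq_bigr => v _; apply: big_fset_incl hd _ => w _ /mcoeff_outdom ->.
by rewrite mulr0 scale0r.
Qed.

Lemma shuffle_linearl q g g' h :
  shuffle (q *: g + g') h = q *: shuffle g h + shuffle g' h.
Proof.
pose d := (msupp (q *: g + g') `|` (msupp g `|` msupp g'))%fset.
have dh := fsubset_refl (msupp h).
rewrite !(@shuffleEw d _ _ _ _ dh) /d ?fsubsetUl //.
- rewrite scaler_sumr -big_split; apply: eq_bigr => v _ /=.
  rewrite scaler_sumr -big_split; apply: eq_bigr => w _ /=.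
  by rewrite scalerA -scalerDl mcoeffD mcoeffZ mulrDl mulrA.
- by rewrite fsetUA fsubsetUr.
- by rewrite fsetUCA fsubsetUl.
Qed.

Lemma shuffle_linearr q g h h' :
  shuffle g (q *: h + h') = q *: shuffle g h + shuffle g h'.
Proof.
pose d := (msupp (q *: h + h') `|` (msupp h `|` msupp h'))%fset.
have dg := fsubset_refl (msupp g).
rewrite !(@shuffleEw _ d _ _ dg) /d ?fsubsetUl //.
- rewrite scaler_sumr -big_split; apply: eq_bigr => v _ /=.
  rewrite scaler_sumr -big_split; apply: eq_bigr => w _ /=.
  by rewrite scalerA -scalerDl mcoeffD mcoeffZ mulrDr mulrCA.
- by rewrite fsetUA fsubsetUr.
- by rewrite fsetUCA fsubsetUl.
Qed.

(* [Zsh], restricted to [H1], is the homomorphism of Q-algebras from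
   (H1, shuffle) to R[T] that extends Z and maps y to T.  Its values outside
   [H1] are irrelevant. *)
Record is_shuffle_regularization (R : realType) (Zsh : hoffman -> {poly R}) :
    Prop := {
  Zsh_add : forall g h, H1 g -> H1 h -> Zsh (g + h) = Zsh g + Zsh h;
  Zsh_scale : forall (q : rat) h, H1 h -> Zsh (q *: h) = ratr q *: Zsh h;
  Zsh_one : Zsh 1 = 1;
  Zsh_shuffle : forall g h, H1 g -> H1 h -> Zsh (shuffle g h) = Zsh g * Zsh h;
  Zsh_extends : forall h, H0 h -> Zsh h = (Zmap R h)%:P;
  Zsh_y : Zsh hy = 'X
}.

(* [merge a [:: b_1; ...] s] is the index a s_1 b_1 s_2 ..., where [true]
   stands for `+' and [false] for `,'. *)
Fixpoint merge_index (a : nat) (k : seq nat) (s : seq bool) : seq nat :=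
  match k, s with
  | b :: k', true :: s' => merge_index (a + b) k' s'
  | b :: k', false :: s' => a :: merge_index b k' s'
  | _, _ => [:: a]
  end.

(* f is a linear extension of X with values in {0, ..., #|X| - 1}; sorting the
   elements of X by their image lists f^-1(0), f^-1(1), ... *)
Definition Wposet (d : Order.disp_t) (X : finPOrderType d)
    (delta : X -> letter) : hoffman :=
  \sum_(f : {ffun X -> 'I_#|X|} |
         injectiveb f && [forall p, forall q, (p < q)%O ==> (f p < f q)%N])
    word [seq delta p | p <- sort (fun p q => f p <= f q)%N (enum X)].

(* The pair (i, m) stands for p_{i+1,m+1}. *)
Definition xstar (k : seq nat) : Type := {i : 'I_(size k) & 'I_(nth 0%N k i)}.

HB.instance Definition _ k := Finite.on (xstar k).

Section StarPoset.
Variable k : seq nat.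
Implicit Types p q : xstar k.

Definition xstar_row p : nat := tag p.
Definition xstar_pos p : nat := tagged p.

Definition xstar_gen : rel (xstar k) := fun p q =>
  (xstar_row q == xstar_row p) && (xstar_pos q == (xstar_pos p).+1)
  || [&& xstar_row q == (xstar_row p).+1, xstar_pos p == 0%N &
         (xstar_pos q).+1 == nth 0%N k (xstar_row q)].

Definition xstar_le : rel (xstar k) := connect xstar_gen.

Lemma xstar_le_refl : reflexive xstar_le.
Proof. exact: connect0. Qed.

Lemma xstar_le_trans : transitive xstar_le.
Proof. exact: connect_trans. Qed.

Lemma xstar_gen_rank p q : xstar_gen p q ->
  (xstar_row p + xstar_pos p < xstar_row q + xstar_pos q)%N.
Proof.
case/orP=> [/andP[/eqP-> /eqP->]|/and3P[/eqP-> /eqP-> _]]; first by rewrite addnS.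
by rewrite addn0 addSn ltnS leq_addr.
Qed.

Lemma xstar_le_rank p q : xstar_le p q ->
  p = q \/ (xstar_row p + xstar_pos p < xstar_row q + xstar_pos q)%N.
Proof.
case/connectP=> s; elim: s p => [|r s IHs] p /=; first by move=> _ ->; left.
case/andP=> /xstar_gen_rank ltpr rs qE; right.
by case: (IHs _ rs qE) => [<- //|]; apply: ltn_trans.
Qed.

Lemma xstar_le_anti : antisymmetric xstar_le.
Proof.
move=> p q /andP[/xstar_le_rank[//|ltpq] /xstar_le_rank[//|]].
by rewrite ltnNge (ltnW ltpq).
Qed.

Definition xstar_label p : letter := if xstar_pos p == 0%N then ly else lx.

End StarPoset.

Fact xstar_display : Order.disp_t. Proof. exact: Order.Disp tt tt. Qed.

HB.instance Definition _ k := Order.Le_isPOrder.Build xstar_display (xstar k)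
  (@xstar_le_refl k) (@xstar_le_anti k) (@xstar_le_trans k).

Definition wstar (k : seq nat) : hoffman := Wposet (@xstar_label k).

Section RegularizedValues.
Variables (R : realType) (Zsh : hoffman -> {poly R}).

Definition zeta_sh (k : seq nat) : R := (Zsh (zmon k)).[0].

Definition zeta_star_sh (k : seq nat) : R :=
  if k is a :: k' then
    \sum_(s : (size k').-tuple bool) zeta_sh (merge_index a k' s)
  else 1.

Definition zeta_star_KY (k : seq nat) : R := (Zsh (wstar k)).[0].

End RegularizedValues.

(* Main.v *)
(* Write s for the shuffle regularized values read from the largest summation
   index down, as a function on indices, and multiply functions on indices by
   deconcatenation.  Trading the relations p_{i,1} < p_{i+1,k_{i+1}} of the
   poset of k for their negations shows that the signed Kaneko-Yamamoto values
   form the inverse of s.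

   On the other side, shuffle regularization is a limit of truncated sums:
   s(1^j, a, t) with a >= 2 is (-1)^j times the sum of n^-a h_j(1, 1/2, ..., 1/n)
   over n and the tail t, where h_j is the complete symmetric polynomial.
   Truncated at N, this is the product of the ordinary truncated sums by the
   series 1 / prod_{m <= N} (1 + u/m) supported on the indices 1^j.  As the
   signed star sums invert the ordinary sums, the truncated s times its signed
   star version is prod_{m <= N} (1 - u^2/m^2)^-1, again supported on the 1^j.
   Letting N tend to infinity, the signed star values are the inverse of s times
   pi u / sin(pi u), whose coefficients of positive degree are multiples of
   zeta(2) by Newton's identities and Euler's recursion for even zeta values. *)
Require Import Defs.
From mathcomp Require Import all_boot all_order all_algebra.
From mathcomp Require Import finmap monalg.
From mathcomp Require Import ring zify.
From mathcomp Require Import boolp classical_sets functions cardinality fsbigop.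
From mathcomp Require Import reals ereal topology normedtype sequences esum.

Set Implicit Arguments.
Unset Strict Implicit.
Unset Printing Implicit Defensive.

Import Order.TTheory GRing.Theory Num.Theory.
Import numFieldNormedType.Exports.

Local Open Scope classical_set_scope.
Local Open Scope ring_scope.

(** * Deconcatenation products and truncated sums *)

Section Convolution.
Variable R : comPzRingType.
Implicit Types f g h : seq nat -> R.

(** A function on indices is a noncommutative power series with one variable X_a per entry a, and
    [conv] is the product of series. Reading from the largest summation index down puts the
    divergent entries 1 at the head, where list recursion meets them.

    The obstacle is that neither factor of the truncated product converges: sums with leading 1 and
    h_j(1, ..., 1/N) grow like powers of log N. Every algebraic identity is therefore exact at each
    N, and limits are taken only of [hreg] and [hsin], where the divergences cancel.

    That [hreg] tends to the regularized values is read off from Taylor coefficients. Regularization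
    expresses (-1)^j s(1^j, a, t) as the integral over [0, 1] of (-log(1-z))^j / j! times a
    convergent polylogarithm against dz/z. Expanding the polylogarithm leaves integrals of z^(n-1)
    (-log(1-z))^j / j!, equal to h_j(1, ..., 1/n) / n. All of this is carried out on
    coefficients. *)

Fixpoint conv f g (l : seq nat) : R :=
  f [::] * g l + (if l is a :: t then conv (fun u => f (a :: u)) g t else 0).

Definition conv1 (l : seq nat) : R := (l == [::])%:R.

Lemma eq_conv f f' g g' l : f =1 f' ->
  (forall t, (size t <= size l)%N -> g t = g' t) -> conv f g l = conv f' g' l.
Proof.
elim: l f f' => [|a t IHt] f f' ff' gg' /=; first by rewrite ff' gg'.
rewrite ff' gg' //; congr (_ + _); apply: IHt => [u|u ut]; first exact: ff'.
by apply: gg'; exact: leqW.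
Qed.

Lemma convDZl c f f' g l :
  conv (fun u => c * f u + f' u) g l = c * conv f g l + conv f' g l.
Proof.
elim: l f f' => [|a t IHt] f f' /=; first by rewrite !addr0 mulrDl mulrA.
by rewrite IHt mulrDl mulrDr addrACA !mulrA.
Qed.

Lemma convZl c f g l : conv (fun u => c * f u) g l = c * conv f g l.
Proof.
elim: l f => [|a t IHt] f /=; first by rewrite !addr0 mulrA.
by rewrite IHt mulrDr mulrA.
Qed.

Lemma conv0l g l : conv (fun=> 0) g l = 0.
Proof. by elim: l => [|a t IHt] /=; rewrite mul0r ?IHt addr0. Qed.

Lemma convA f g h l : conv (conv f g) h l = conv f (conv g h) l.
Proof.
elim: l f => [|a t IHt] f /=; first by rewrite !addr0 mulrA.
rewrite convDZl IHt addr0 mulrDr !mulrA -!addrA; congr (_ + _).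
Qed.

Lemma conv1l g l : conv conv1 g l = g l.
Proof.
case: l => [|a t] /=; rewrite mul1r; first by rewrite addr0.
by rewrite (@eq_conv _ (fun=> 0) _ g) // conv0l addr0.
Qed.

Lemma conv1r f l : conv f conv1 l = f l.
Proof.
elim: l f => [|a t IHt] f /=; first by rewrite addr0 mulr1.
by rewrite IHt mulr0 add0r.
Qed.

Lemma conv_single f g l : (forall t, size t != 1%N -> g t = 0) ->
  conv f g l = if rev l is a :: t then f (rev t) * g [:: a] else 0.
Proof.
move=> g0; elim/last_ind: l => [|l a _] /=; first by rewrite g0 // mulr0 addr0.
rewrite rev_rcons revK; elim: l f => [|b l IHl] f /=.
  by rewrite (g0 [::]) // mulr0 !addr0.
by rewrite IHl g0 ?mulr0 ?add0r //= size_rcons.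
Qed.

(** The empty prefix contributes [g l] itself and every other prefix involves [g] on a shorter list,
    so [g] is determined by induction on length. *)
Lemma conv_injl f g g' : f [::] = 1 ->
  (forall l, conv f g l = conv f g' l) -> g =1 g'.
Proof.
move=> f1 eqc l; elim/ltn_ind: {l}(size l) {-2}l (erefl (size l)) => n IHn l szl.
have := eqc l; case: l szl => [|a t] szl /=; first by rewrite f1 !mul1r !addr0.
rewrite f1 !mul1r (@eq_conv _ (fun u => f (a :: u)) _ g') //; first exact: addIr.
by move=> u ut; apply: (IHn (size u)) => //; rewrite -szl ltnS.
Qed.

(** Cancel [f] on the left in f (g f) = (f g) f = f. *)
Lemma conv_inv f g : f [::] = 1 -> conv f g =1 conv1 -> conv g f =1 conv1.
Proof.
move=> f1 fg; apply: (conv_injl f1) => l.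
by rewrite conv1r -convA -[RHS]conv1l; apply: eq_conv.
Qed.

Lemma conv_sum f g l :
  conv f g l = \sum_(i < (size l).+1) f (take i l) * g (drop i l).
Proof.
elim: l f => [|a t IHt] f /=; first by rewrite big_ord1 addr0.
by rewrite big_ord_recl IHt.
Qed.

Lemma conv_rev f g l :
  conv f g (rev l) = conv (fun u => g (rev u)) (fun u => f (rev u)) l.
Proof.
rewrite !conv_sum size_rev (reindex_inj rev_ord_inj) /=; apply: eq_bigr => i _.
rewrite subSS mulrC take_rev drop_rev subKn // -ltnS; exact: ltn_ord.
Qed.

(** The series in the single variable X_1 with coefficients [q]; such series multiply by the Cauchy
    product of coefficients. *)
Definition ones (q : nat -> R) (l : seq nat) : R :=
  if all (pred1 1%N) l then q (size l) else 0.

Lemma ones_cons q a t : ones q (a :: t) = (a == 1%N)%:R * ones (fun i => q i.+1) t.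
Proof. by rewrite /ones /=; case: eqP => //= _; rewrite ?mul1r ?mul0r. Qed.

Lemma ones_rev q l : ones q (rev l) = ones q l.
Proof. by rewrite /ones all_rev size_rev. Qed.

Lemma conv_ones_cons q g a t : conv (ones q) g (a :: t) =
  q 0%N * g (a :: t) + (a == 1%N)%:R * conv (ones (fun i => q i.+1)) g t.
Proof.
rewrite /=; congr (_ + _); rewrite -convZl; apply: eq_conv => // u.
exact: ones_cons.
Qed.

Definition cauchy_prod (p q : nat -> R) (n : nat) : R :=
  \sum_(i < n.+1) p i * q (n - i)%N.

Lemma cauchyS p q n : cauchy_prod p q n.+1 =
  p 0%N * q n.+1 + cauchy_prod (fun i => p i.+1) q n.
Proof. by rewrite /cauchy_prod big_ord_recl subn0. Qed.

Lemma cauchyC p q n : cauchy_prod p q n = cauchy_prod q p n.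
Proof.
rewrite /cauchy_prod (reindex_inj rev_ord_inj) /=; apply: eq_bigr => i _.
by rewrite subSS subKn 1?mulrC // -ltnS ltn_ord.
Qed.

Lemma conv_ones p q l : conv (ones p) (ones q) l = ones (cauchy_prod p q) l.
Proof.
elim: l p => [|a t IHt] p; first by rewrite /= addr0 /ones /= /cauchy_prod big_ord1.
rewrite conv_ones_cons IHt !ones_cons mulrCA -mulrDr; congr (_ * _).
by rewrite /ones cauchyS; case: ifP; rewrite ?mulr0 ?addr0.
Qed.

(** The substitution of -X_a for every X_a, hence multiplicative for [conv]. *)
Definition signed (f : seq nat -> R) (l : seq nat) : R := (-1) ^+ size l * f l.

Lemma conv_signed f g l : conv (signed f) (signed g) l = signed (conv f g) l.
Proof.
rewrite /signed !conv_sum mulr_sumr; apply: eq_bigr => i _.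
have szE : (-1) ^+ size l = (-1) ^+ size (take i l) * (-1) ^+ size (drop i l) :> R.
  by rewrite -exprD -size_cat cat_take_drop.
by rewrite szE; ring.
Qed.

End Convolution.

(** * Star sums as sums over merged indices *)

Section MergeSums.
Variable R : comPzRingType.
Implicit Types G : seq nat -> R.

(** The entry [a] is still being accumulated, while the finished entries have been absorbed into
    [G]. *)
Fixpoint merge_sum G a (t : seq nat) : R :=
  if t is b :: t' then
    merge_sum G (a + b) t' + merge_sum (fun l => G (a :: l)) b t'
  else G [:: a].

Definition star_sum G (l : seq nat) : R :=
  if l is a :: t then merge_sum G a t else G [::].

Lemma merge_sum_tuple G a t :
  \sum_(s : (size t).-tuple bool) G (merge_index a t s) = merge_sum G a t.
Proof.
elim: t a G => [|b t IHt] a G /=.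
  rewrite (big_pred1 [tuple]) // => s; apply/esym/eqP/val_inj.
  by rewrite (tuple0 s).
rewrite -!IHt.
rewrite (reindex (fun p : bool * (size t).-tuple bool => cons_tuple p.1 p.2)) /=; last first.
  exists (fun s => (thead s, behead_tuple s)) => [[c s] _|s _] /=.
    by congr pair; apply: val_inj.
  by rewrite [RHS]tuple_eta; apply: val_inj.
by rewrite -(pair_bigA _ (fun (c : bool) (s : (size t).-tuple bool) =>
  G (if c then merge_index (a + b) t s else a :: merge_index b t s))) big_bool.
Qed.

Lemma eq_merge_sum G G' a t :
  (forall c u, G (c :: u) = G' (c :: u)) -> merge_sum G a t = merge_sum G' a t.
Proof.
elim: t a G G' => [|b t IHt] a G G' GG' /=; first exact: GG'.
by congr (_ + _); apply: IHt => *; exact: GG'.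
Qed.

Lemma merge_sumD G G' a t :
  merge_sum (fun l => G l + G' l) a t = merge_sum G a t + merge_sum G' a t.
Proof.
elim: t a G G' => [|b t IHt] a G G' //=.
by rewrite IHt (IHt _ (fun l => G (a :: l)) (fun l => G' (a :: l))) addrACA.
Qed.

Lemma merge_sumZ c G a t :
  merge_sum (fun l => c * G l) a t = c * merge_sum G a t.
Proof. by elim: t a G => [|b t IHt] a G //=; rewrite !IHt mulrDr. Qed.

Definition add_head a (l : seq nat) : seq nat :=
  if l is b :: t then (a + b)%N :: t else [::].

Lemma merge_sum_head G a b t :
  merge_sum (fun l => G (add_head a l)) b t = merge_sum G (a + b) t.
Proof. by elim: t b G => [|c t IHt] b G //=; rewrite IHt addnA. Qed.

(** The last separator is a comma, which appends [b], or a plus, which adds [b] to the last entry;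
    the latter is [add_head] on the reversed list. *)
Lemma merge_sum_rcons G a t b :
  merge_sum G a (rcons t b) =
  merge_sum (fun l => G (rcons l b) + G (rev (add_head b (rev l)))) a t.
Proof.
elim: t a G => [|c t IHt] a G /=; first by rewrite addrC addnC.
rewrite !IHt; congr (_ + _); apply: eq_merge_sum => d u.
congr (_ + _); congr G; rewrite !rev_cons.
by case: (rev u) => [|e v] //=; rewrite !rev_cons !rev_rcons.
Qed.

(** Merges of the reversed index are the reversed merges. The recursion peels off the first entry on
    one side and the last one on the other, which [merge_sum_rcons] reconciles. *)
Lemma star_sum_rev G l : star_sum (fun u => G (rev u)) (rev l) = star_sum G l.
Proof.
case: l => [|a l] //; elim: l a G => [|b t IHt] a G //.
rewrite rev_cons; have : rev (b :: t) = rev (b :: t) by [].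
case: {2 3}(rev (b :: t)) => [/(congr1 size)|c u revE]; first by rewrite size_rev.
rewrite rcons_cons /star_sum merge_sum_rcons [RHS]/= -merge_sum_head -merge_sumD.
have /= <- := IHt b (fun l => G (add_head a l) + G (a :: l)).
by rewrite revE /=; apply: eq_merge_sum => d v; rewrite rev_rcons revK addrC.
Qed.

End MergeSums.

(** * Generating series in one variable *)

Section CauchyProducts.
Variable R : comPzRingType.
Implicit Types p q r : nat -> R.

Lemma eq_cauchy p p' q q' : p =1 p' -> q =1 q' -> cauchy_prod p q =1 cauchy_prod p' q'.
Proof. by move=> pp' qq' n; apply: eq_bigr => i _; rewrite pp' qq'. Qed.

(** Associativity is transported from [conv] through the embedding [ones]. *)
Lemma cauchyA p q r n : cauchy_prod (cauchy_prod p q) r n = cauchy_prod p (cauchy_prod q r) n.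
Proof.
have onesE s m : ones s (nseq m 1%N) = s m :> R.
  by rewrite /ones all_nseq orbT size_nseq.
rewrite -(onesE (cauchy_prod p _)) -(onesE (cauchy_prod _ r)) -!conv_ones.
rewrite (@eq_conv _ _ (conv (ones p) (ones q)) _ (ones r)) => [|u|//]; last first.
  by rewrite conv_ones.
by rewrite convA; apply: eq_conv => // u _; rewrite conv_ones.
Qed.

(** Here and in the next two lemmas [nth 0 s] is the polynomial with coefficient list [s],
    multiplied out one coefficient at a time. *)
Lemma cauchy_nil q n : cauchy_prod (nth 0 [::]) q n = 0.
Proof. by apply: big1 => i _; rewrite nth_nil mul0r. Qed.

Lemma cauchy_cons0 a s q : cauchy_prod (nth 0 (a :: s)) q 0 = a * q 0%N.
Proof. by rewrite /cauchy_prod big_ord1. Qed.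

Lemma cauchy_consS a s q n :
  cauchy_prod (nth 0 (a :: s)) q n.+1 = a * q n.+1 + cauchy_prod (nth 0 s) q n.
Proof. exact: cauchyS. Qed.

(** For generating series the hypotheses say k(u) = (1 - y u) h(u), so k(-u) k(u) = (1 - y^2 u^2)
    h(-u) h(u); the conclusion reads off coefficients. *)
Lemma cauchy_sign_step (y : R) (h k : nat -> R) :
  h 0%N = k 0%N -> (forall i, h i.+1 = k i.+1 + y * h i) ->
  forall m, let F u := cauchy_prod (fun i => (-1) ^+ i * u i) u in
    [/\ F h 0%N = k 0%N ^+ 2, F h 1%N = F k 1%N &
        F h m.+2 = F k m.+2 + y ^+ 2 * F h m].
Proof.
move=> h0 hS m F.
have kE : k =1 cauchy_prod (nth 0 [:: 1; - y]) h.
  case=> [|i]; rewrite ?cauchy_cons0 ?mul1r // cauchy_consS.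
  case: i => [|i]; rewrite ?cauchy_cons0 ?cauchy_consS ?cauchy_nil hS; ring.
have qE : (fun i => (-1) ^+ i * k i) =1
    cauchy_prod (fun i => (-1) ^+ i * h i) (nth 0 [:: 1; y]).
  move=> i; rewrite cauchyC.
  case: i => [|i]; rewrite ?cauchy_cons0 ?cauchy_consS ?mul1r ?h0 //.
  case: i => [|i]; rewrite ?cauchy_cons0 ?cauchy_consS ?cauchy_nil hS !exprS; ring.
have FE : F k =1 cauchy_prod (nth 0 [:: 1; 0; - y ^+ 2]) (F h).
  move=> n; rewrite /F (eq_cauchy qE kE) cauchyA.
  pose l3 := nth 0 [:: 1; 0; - y ^+ 2].
  transitivity (cauchy_prod (fun i => (-1) ^+ i * h i) (cauchy_prod l3 h) n).
    apply: eq_cauchy => // i; rewrite -cauchyA; apply: eq_cauchy => // {}i.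
    case: i => [|[|[|i]]]; rewrite /l3 ?(cauchy_cons0, cauchy_consS, cauchy_nil) /= ?nth_nil; ring.
  rewrite -!cauchyA; apply: eq_cauchy => // i; exact: cauchyC.
split; first by rewrite /F /cauchy_prod big_ord1 /= h0 expr0; ring.
  by rewrite FE !(cauchy_cons0, cauchy_consS); ring.
rewrite FE !cauchy_consS; case: m => [|m].
  by rewrite cauchy_cons0; ring.
by rewrite cauchy_consS cauchy_nil; ring.
Qed.

End CauchyProducts.

(** * Truncated sums and their regularization *)

Section TruncatedSums.
Variable R : numFieldType.

Fixpoint hsum (l : seq nat) (N : nat) : R :=
  if l is a :: t then \sum_(n < N) n.+1%:R ^- a * hsum t n else 1.

Fixpoint hstar (l : seq nat) (N : nat) : R :=
  if l is a :: t then \sum_(n < N) n.+1%:R ^- a * hstar t n.+1 else 1.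

Lemma hsumS a t N : hsum (a :: t) N.+1 = hsum (a :: t) N + N.+1%:R ^- a * hsum t N.
Proof. by rewrite /= big_ord_recr. Qed.

Lemma hstarS a t N :
  hstar (a :: t) N.+1 = hstar (a :: t) N + N.+1%:R ^- a * hstar t N.+1.
Proof. by rewrite /= big_ord_recr. Qed.

Lemma hsum0 l : hsum l 0 = (l == [::])%:R.
Proof. by case: l => [|a t] //=; rewrite big_ord0. Qed.

Lemma hstar0 l : hstar l 0 = (l == [::])%:R.
Proof. by case: l => [|a t] //=; rewrite big_ord0. Qed.

Lemma hsum_ge0 l N : 0 <= hsum l N.
Proof.
elim: l N => [|a t IHt] N //=; apply: sumr_ge0 => n _.
by rewrite mulr_ge0 // invr_ge0 exprn_ge0.
Qed.

(** The series of [hsum^~ N] is the product of factors 1 + x_n for n from N down to 1. Inverting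
    reverses their order and expands each factor into a geometric series, whence the reversal, the
    weak inequalities and the sign. *)
Definition hstar_inv N : seq nat -> R := signed (fun l => hstar (rev l) N).

(* The factor [1 + \sum_a n^-a X_a] of the ordered product over n of which
   [hsum^~ N] is the generating series. *)
Definition level (n : nat) (l : seq nat) : R :=
  if l is a :: t then (if t is [::] then n%:R ^- a else 0) else 1.

Lemma conv_level N l : conv (level N.+1) (hsum^~ N) l = hsum l N.+1.
Proof.
case: l => [|a t]; first by rewrite /= mul1r addr0.
rewrite hsumS /= mul1r; congr (_ + _).
case: t => [|b t] /=; first by rewrite mulr1 addr0.
by rewrite (@eq_conv _ _ (fun=> 0) _ (hsum^~ N)) // conv0l addr0.
Qed.

(** Convolution with the part of [level] on singletons splits off the last entry of [l], the head of
    [rev l]; this is the recursion [hstarS] with a sign. *)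
Lemma hstar_inv_level N l : conv (hstar_inv N.+1) (level N.+1) l = hstar_inv N l.
Proof.
pose x l := level N.+1 l - conv1 R l.
have -> : conv (hstar_inv N.+1) (level N.+1) l =
    hstar_inv N.+1 l + conv (hstar_inv N.+1) x l.
  rewrite -[X in X + _](conv1r (hstar_inv N.+1)) !conv_sum -big_split.
  by apply: eq_bigr => i _; rewrite /= -mulrDr /x addrC subrK.
rewrite conv_single => [|[|a [|b t]] //= _]; last 2 first.
- by rewrite /x /conv1 subrr.
- by rewrite /x /conv1 subrr.
rewrite /hstar_inv /signed -(size_rev l); case: (rev l) => [|a t]; first by rewrite /= addr0.
by rewrite hstarS revK size_rev /x /conv1 /= exprS; ring.
Qed.

Lemma hsum_hstar N l : conv (hsum^~ N) (hstar_inv N) l = conv1 R l.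
Proof.
(* In the opposite order [hstar_inv N.+1] and [level N.+1] are adjacent, so the product telescopes
   in N. *)
apply: conv_inv => [|{}l]; first by rewrite /hstar_inv /signed /= mulr1.
elim: N l => [|N IHN] l.
  rewrite (@eq_conv _ _ (conv1 R) _ (conv1 R)) ?conv1r // => [u|u _]; last exact: hsum0.
  by rewrite /hstar_inv /signed hstar0 /conv1; case/lastP: u => [|u a];
    rewrite ?mulr1 // rev_rcons mulr0 -size_eq0 size_rcons.
rewrite (@eq_conv _ _ (hstar_inv N.+1) _ (conv (level N.+1) (hsum^~ N))) //.
  rewrite -convA -IHN; apply: eq_conv => // u; exact: hstar_inv_level.
by move=> u _; rewrite conv_level.
Qed.

(** The complete symmetric polynomial h_i(1, 1/2, ..., 1/N), the coefficient of u^i in prod_{m <= N}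
    (1 - u/m)^-1. *)
Definition hone i N : R := hstar (nseq i 1%N) N.
Definition hone_sgn N i : R := (-1) ^+ i * hone i N.
Definition hreg N : seq nat -> R := conv (ones (hone_sgn N)) (hsum^~ N).

(** A comma stands for a strict inequality between neighbouring summation variables, a plus for an
    equality. *)
Lemma merge_sum_hsum N a t : merge_sum (hsum^~ N) a t = hstar (a :: t) N.
Proof.
elim: t a N => [|b t IHt] a N //.
rewrite -[LHS]/(merge_sum _ (a + b) t + merge_sum _ b t) IHt.
suff -> M : merge_sum (fun l => \sum_(n < M) n.+1%:R ^- a * hsum l n) b t =
    \sum_(n < M) n.+1%:R ^- a * hstar (b :: t) n.
  rewrite -[hstar (_ + _ :: _)%N N]/(\sum_(n < N) n.+1%:R ^- (a + b) * hstar t n.+1).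
  rewrite -[hstar _ N]/(\sum_(n < N) n.+1%:R ^- a * hstar (b :: t) n.+1).
  rewrite -big_split; apply: eq_bigr => n _; rewrite hstarS mulrDr addrC.
  by congr (_ + _); rewrite exprD invfM mulrA.
elim: M => [|M IHM].
  rewrite big_ord0 -[RHS](mul0r (merge_sum (hsum^~ 0) b t)) -merge_sumZ.
  by apply: eq_merge_sum => *; rewrite big_ord0 mul0r.
rewrite [RHS]big_ord_recr -IHM -(IHt b M) -merge_sumZ /= -merge_sumD.
by apply: eq_merge_sum => *; rewrite big_ord_recr.
Qed.

(** A plus between positive entries gives an entry at least 2. A prefix of ones in a merged index
    therefore consists of unmerged entries of [l], and the rest ranges over all merges of the
    remainder. *)
Lemma star_sum_hreg q N l : is_index l ->
  star_sum (conv (ones q) (hsum^~ N)) l = conv (ones q) (hstar^~ N) l.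
Proof.
have big d a t : (1 < a)%N -> merge_sum (conv (ones d) (hsum^~ N)) a t =
    d 0%N * hstar (a :: t) N.
  move=> a1; rewrite -merge_sum_hsum -merge_sumZ.
  elim: t a a1 => [|b t IHt] a a1.
    rewrite -[LHS]/(conv (ones d) (hsum^~ N) [:: a]) conv_ones_cons.
    by rewrite -(negbK (a == _)) neq_ltn a1 orbT mul0r addr0.
  rewrite -[LHS]/(merge_sum _ (a + b) t + merge_sum _ b t).
  rewrite -[RHS]/(merge_sum _ (a + b) t + merge_sum _ b t).
  rewrite IHt ?(leq_trans a1) ?leq_addr //; congr (_ + _); apply: eq_merge_sum => c u.
  by rewrite conv_ones_cons -(negbK (a == _)) neq_ltn a1 orbT mul0r addr0.
elim: l q => [|a [|b t] IHt] q // /andP[a0 tP].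
rewrite -[LHS]/(merge_sum _ a (b :: t)) -[RHS]/(conv _ _ (a :: b :: t)).
have {IHt} := IHt (fun i => q i.+1) tP; move=> IHt.
rewrite conv_ones_cons; case: (ltngtP a 1) a0 => // [a1|->] _.
  by rewrite big // mul0r addr0.
rewrite mul1r -IHt -merge_sum_hsum -[LHS]/(merge_sum _ (1 + b) t + merge_sum _ b t).
rewrite big ?add1n; last by case/andP: tP.
rewrite -[merge_sum _ 1 _]/(merge_sum _ (1 + b) t + merge_sum (fun l => hsum (1%N :: l) N) b t).
rewrite mulrDr -addrA -merge_sum_hsum; congr (_ + _).
rewrite -merge_sumZ -merge_sumD; apply: eq_merge_sum => c u.
by rewrite conv_ones_cons mul1r.
Qed.

(** Reversal exchanges the two factors of [star_sum_hreg]; the sign turns [hone_sgn] into [hone] and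
    the reversed [hstar] into [hstar_inv]. *)
Lemma signed_star_sum_hreg N l : is_index l ->
  signed (fun k => star_sum (hreg N) (rev k)) l =
  conv (hstar_inv N) (ones (hone^~ N)) l.
Proof.
move=> lP; rewrite /signed star_sum_hreg ?conv_rev; last by rewrite /is_index all_rev.
rewrite -[LHS]conv_signed; apply: eq_conv => // u _.
rewrite /signed ones_rev /ones; case: ifP; rewrite ?mulr0 // => _.
by rewrite /hone_sgn mulrA -exprMn mulrNN mulr1 expr1n mul1r.
Qed.

Definition hsin N (m : nat) : R := cauchy_prod (hone_sgn N) (hone^~ N) m.

Lemma honeS i N : hone i.+1 N.+1 = hone i.+1 N + N.+1%:R^-1 * hone i N.+1.
Proof. by rewrite /hone [nseq _ _]/= hstarS expr1. Qed.

Lemma hsin_rec N m :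
  [/\ hsin N 0 = 1, hsin N 1 = 0 &
      hsin N.+1 m.+2 = hsin N m.+2 + N.+1%:R ^- 2 * hsin N.+1 m].
Proof.
have stepN M := @cauchy_sign_step R M.+1%:R^-1 (hone^~ M.+1) (hone^~ M)
  (erefl _) (fun i => honeS i M).
split; last by case: (stepN N m) => _ _; rewrite exprVn.
  by rewrite /hsin /cauchy_prod big_ord1 /hone_sgn mulr1 mulr1.
elim: N => [|N IHN]; last by case: (stepN N 0%N) => _ F1 _; rewrite -IHN; exact: F1.
by rewrite /hsin /cauchy_prod big_ord_recl big_ord1 /= /hone_sgn /hone /= !big_ord0; ring.
Qed.

Lemma hsin0 m : hsin 0 m.+1 = 0.
Proof.
rewrite /hsin /cauchy_prod big1 // => i _; rewrite /hone_sgn /hone !hstar0.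
by case: i => -[|i] ? /=; rewrite ?mulr0 ?mul0r.
Qed.

(** The inner factors [hsum^~ N] and [hstar_inv N] cancel, leaving a product of two series in
    X_1. *)
Lemma conv_hreg_star N l : is_index l ->
  conv (hreg N) (signed (fun k => star_sum (hreg N) (rev k))) l = ones (hsin N) l.
Proof.
move=> lP; transitivity (conv (hreg N) (conv (hstar_inv N) (ones (hone^~ N))) l).
  rewrite !conv_sum; apply: eq_bigr => i _; congr (_ * _).
  apply: signed_star_sum_hreg; apply/allP => a /mem_drop; exact: (allP lP).
rewrite /hreg convA -conv_ones; apply: eq_conv => // u _.
rewrite -convA -[RHS]conv1l; apply: eq_conv => // {}u; exact: hsum_hstar.
Qed.

Lemma hone_sgnS i N :
  hone_sgn N.+1 i.+1 = hone_sgn N i.+1 - N.+1%:R^-1 * hone_sgn N.+1 i.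
Proof. by rewrite /hone_sgn honeS exprS; ring. Qed.

(** As series, [ones (hone_sgn N.+1)] times 1 + X_1/(N+1) is [ones (hone_sgn N)]. This absorbs the
    variable X_1 of [level N.+1], so only an entry other than 1 just after the leading ones
    contributes a new term. *)
Lemma hreg_step N j r : (if r is a :: t then a != 1%N else true) ->
  hreg N.+1 (nseq j 1%N ++ r) = hreg N (nseq j 1%N ++ r) +
    (if r is a :: t then N.+1%:R ^- a * hone_sgn N.+1 j * hsum t N else 0).
Proof.
move=> r1; rewrite /hreg.
(* Induction on [j] shifts the coefficients by [d]. The last term is the change of the coefficient
   of degree [d], which vanishes at d = 0. *)
suff C d : conv (ones (fun i => hone_sgn N.+1 (d + i))) (hsum^~ N.+1) (nseq j 1%N ++ r) =
    conv (ones (fun i => hone_sgn N (d + i))) (hsum^~ N) (nseq j 1%N ++ r) +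
    (if r is a :: t then N.+1%:R ^- a * hone_sgn N.+1 (d + j) * hsum t N else 0) +
    (hone_sgn N.+1 d - hone_sgn N d) * hsum (nseq j 1%N ++ r) N.
  have := C 0%N; rewrite /hone_sgn /hone /= subrr mul0r addr0; exact.
elim: j d => [|j IHj] d; rewrite [nseq _ _ ++ _]/=.
  case: r r1 => [_|a t a1].
    by rewrite /= /ones /= !addn0 !mulr1 !addr0 addrC subrK.
  rewrite !conv_ones_cons !addn0 (negbTE a1) hsumS !mul0r !addr0.
  move: (hone_sgn N.+1 d) (hone_sgn N d) (hsum _ _) (hsum _ _) (_ ^- a) => u v w z x.
  ring.
have shift M g u : conv (ones (fun i => hone_sgn M (d + i.+1))) g u =
    conv (ones (fun i => hone_sgn M (d.+1 + i))) g u.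
  by apply: eq_conv => // v; rewrite /ones addSnnS.
rewrite !conv_ones_cons !shift !addn0 eqxx IHj hone_sgnS hsumS addSnnS mul1r expr1.
move: (hone_sgn N.+1 d) (hone_sgn N d) (hone_sgn _ _) (hsum _ _) (hsum _ _) (conv _ _ _) => u v u' w z c.
move: (match r with | [::] => _ | _ :: _ => _ end) (_^-1) => x y.
by rewrite mulr1n; ring.
Qed.

Lemma hreg_ones N j : hreg N (nseq j 1%N) = (j == 0%N)%:R.
Proof.
elim: N => [|N IHN]; last by have := @hreg_step N j [::] isT; rewrite cats0 addr0 IHN.
rewrite /hreg (@eq_conv _ _ (ones (hone_sgn 0)) _ (conv1 R)) // => [|u _]; last exact: hsum0.
rewrite conv1r /ones all_nseq orbT size_nseq /hone_sgn /hone hstar0.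
by case: j => [|j]; rewrite ?mulr1 //= mulr0.
Qed.

Lemma hreg_cat_ones N j a t : (1 < a)%N -> hreg N (nseq j 1%N ++ a :: t) =
  \sum_(n < N) n.+1%:R ^- a * hone_sgn n.+1 j * hsum t n.
Proof.
move=> a1; elim: N => [|N IHN]; last first.
  by rewrite hreg_step ?big_ord_recr ?IHN // neq_ltn a1 orbT.
rewrite big_ord0 /hreg (@eq_conv _ _ (ones (hone_sgn 0)) _ (conv1 R)) // => [|u _]; last exact: hsum0.
rewrite conv1r /ones all_cat /= andbC.
by case: a a1 => [|[]].
Qed.

End TruncatedSums.

(** * Linear extensions *)

Fixpoint shuffles {T : Type} (v1 : seq T) : seq T -> seq (seq T) :=
  if v1 is a1 :: w1 then
    fix shuffles_v1 (v2 : seq T) : seq (seq T) :=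
      if v2 is a2 :: w2 then
        [seq a1 :: w | w <- shuffles w1 v2] ++ [seq a2 :: w | w <- shuffles_v1 w2]
      else [:: v1]
  else fun v2 => [:: v2].

Lemma shuffles_cons (T : Type) (a b : T) v w : shuffles (a :: v) (b :: w) =
  [seq a :: u | u <- shuffles v (b :: w)] ++ [seq b :: u | u <- shuffles (a :: v) w].
Proof. by []. Qed.

Lemma shuffles_nilr (T : Type) (v : seq T) : shuffles v [::] = [:: v].
Proof. by case: v. Qed.

Lemma shuffles_map (T U : Type) (g : T -> U) v w :
  shuffles (map g v) (map g w) = map (map g) (shuffles v w).
Proof.
elim: v w => [|a v IHv] // w; elim: w => [|b w IHw] //.
rewrite [map g (a :: v)]/= [map g (b :: w)]/= !shuffles_cons map_cat -!map_comp.
by rewrite -/(map g (a :: v)) IHw (IHv (b :: w)) -!map_comp.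
Qed.

Lemma size_shuffles (T : eqType) (v w u : seq T) :
  u \in shuffles v w -> size u = (size v + size w)%N.
Proof.
elim: v w u => [|a v IHv] w u; first by rewrite inE => /eqP->.
elim: w u => [|b w IHw] u; first by rewrite inE => /eqP->; rewrite addn0.
rewrite shuffles_cons mem_cat => /orP[] /mapP[s sP ->] /=; first by rewrite (IHv _ _ sP).
by rewrite (IHw _ sP) /= addnS.
Qed.

Section LinearExtensions.
Variables (T : eqType) (V : zmodType).
Implicit Types (R : rel T) (A s : seq T) (f : seq T -> V).

(* Sequences list the elements from the top down, and [R p q] forces p to lie
   below q; no property of [R] is assumed. *)
Definition topdown R s : bool := pairwise (fun p q => ~~ R p q) s.

Definition linsum R A f : V := \sum_(s <- permutations A | topdown R s) f s.

Lemma eq_linsum R R' A f f' : {in A &, R =2 R'} ->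
  (forall s, perm_eq s A -> topdown R s -> f s = f' s) -> linsum R A f = linsum R' A f'.
Proof.
move=> RR' ff'; rewrite /linsum big_seq_cond [RHS]big_seq_cond.
have RE s : perm_eq s A -> topdown R s = topdown R' s.
  move=> sA; apply: (@eq_in_pairwise _ (mem A)); last first.
    by apply/allP => p; rewrite (perm_mem sA).
  by move=> p q pA qA; rewrite RR'.
apply: eq_big => [s|s]; rewrite mem_permutations; first by case sA: (perm_eq s A) => //=; rewrite RE.
by case/andP => /ff' ff /ff.
Qed.

Lemma perm_linsum R A A' f : perm_eq A A' -> linsum R A f = linsum R A' f.
Proof. by move=> AA'; apply: perm_big; apply: perm_permutations. Qed.

Lemma linsum_nil R f : linsum R [::] f = f [::].
Proof. by rewrite /linsum big_cons big_nil addr0. Qed.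

Lemma linsum_cons R A f : uniq A -> A != [::] -> linsum R A f =
  \sum_(p <- A | all (fun q => ~~ R p q) (rem p A))
     linsum R (rem p A) (fun s => f (p :: s)).
Proof.
move=> uA A0; rewrite /linsum.
have permA : perm_eq (permutations A)
    [seq p :: s | p <- A, s <- permutations (rem p A)].
  apply: uniq_perm; first exact: permutations_uniq.
    apply: allpairs_uniq_dep => // [p _|[p s] [q t] _ _ [-> ->] //].
    exact: permutations_uniq.
  move=> s; rewrite mem_permutations; apply/idP/allpairsPdep => [|[p [t [pA tA ->]]]].
    case: s => [|p s] sA; first by rewrite -(negbK (A == _)) -size_eq0 -(perm_size sA) in A0.
    have pA : p \in A by rewrite -(perm_mem sA) mem_head.
    exists p, s; rewrite mem_permutations; split=> //.
    by rewrite -(perm_cons p) (perm_trans sA) ?perm_to_rem.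
  rewrite perm_sym (perm_trans (perm_to_rem pA)) // perm_cons perm_sym.
  by rewrite -mem_permutations.
rewrite [LHS](perm_big [seq p :: s | p <- A, s <- permutations (rem p A)]) //=.
rewrite big_mkcond big_allpairs_dep [RHS]big_mkcond.
apply: eq_bigr => p _; rewrite -big_mkcond /=.
case: ifP => pR; rewrite big_seq_cond; last first.
  apply: big_pred0 => s; rewrite mem_permutations.
  by case sA: (perm_eq s _) => //=; rewrite (perm_all _ sA) pR.
rewrite [RHS]big_seq_cond; apply: eq_bigl => s; rewrite mem_permutations.
by case sA: (perm_eq s _) => //=; rewrite (perm_all _ sA) pR.
Qed.
End LinearExtensions.

Section LinearExtensionSums.
Variables (T : eqType) (V : zmodType).
Implicit Types (R : rel T) (A s : seq T) (f : seq T -> V).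

Lemma rem_cat (p : T) (B C : seq T) :
  rem p (B ++ C) = if p \in B then rem p B ++ C else B ++ rem p C.
Proof.
elim: B => [|b B IHB] //=; rewrite inE eq_sym; case: eqP => //= _.
by rewrite IHB; case: ifP.
Qed.

Lemma linsum_chain R c f : uniq c -> sorted (fun p q => R q p) c ->
  pairwise (fun p q => ~~ R p q) c -> linsum R c f = f c.
Proof.
elim: c f => [|p c IHc] f; first by rewrite linsum_nil.
rewrite pairwise_cons => uc sc /andP[pc wc]; rewrite linsum_cons // big_cons /= eqxx pc.
rewrite (IHc _ _ (path_sorted sc) wc); last by case/andP: uc.
rewrite big_seq_cond big_pred0 ?addr0 // => q.
apply/andP => -[/= qc]; case/splitPr: qc sc uc {IHc pc wc} => c1 c2.
rewrite /= cat_path /= => /and3P[_ Rq _]; rewrite -/(uniq (p :: c1 ++ q :: c2)) => uc.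
move/allP/(_ (last p c1)); rewrite -[if _ then _ else _]/(rem q (p :: c1 ++ q :: c2)).
rewrite mem_rem_uniq // inE -cat_cons mem_cat mem_last Rq andbT.
move: uc; rewrite -cat_cons cat_uniq => /and3P[_ /hasPn/(_ q (mem_head _ _)) qpc1 _].
by case: eqP (mem_last p c1) => [->|_ _ /(_ isT)] //; rewrite (negbTE qpc1).
Qed.

Definition addrel R a b : rel T := fun p q => R p q || ((p == a) && (q == b)).

Lemma not_before_xor a b s : uniq s -> a != b -> a \in s -> b \in s ->
  pairwise (fun p q => ~~ ((p == a) && (q == b))) s =
  ~~ pairwise (fun p q => ~~ ((p == b) && (q == a))) s.
Proof.
have trivw x y t : (x \notin t) || (y \notin t) ->
    pairwise (fun p q => ~~ ((p == x) && (q == y))) t.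
  elim: t => [|c t IHt] //=; rewrite !inE !negb_or => xy; apply/andP; split; last first.
    by apply: IHt; case/orP: xy => /andP[_ ->]; rewrite ?orbT.
  apply/allP => q qt; case: eqP => //= cx; apply: contraTN xy => /eqP <-.
  by rewrite negb_or cx eqxx /= qt andbF.
have allF x t : x \in t -> all (fun q => q != x) t = false.
  by move=> xt; apply/negP => /allP/(_ x xt); rewrite eqxx.
have allT (t : seq T) : all (fun=> true) t by elim: t.
elim: s => [|c s IHs] //= /andP[cs us] ab; rewrite !inE.
case: (eqVneq a c) => [ac|ac] /=.
  rewrite -{}ac (negbTE ab) /= in cs * => _; rewrite eq_sym (negbTE ab) /= => bs.
  by rewrite allF //= [all _ s](allT s) trivw // cs orbT.
case: (eqVneq b c) => [bc|bc] /=.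
  rewrite -{}bc in ac cs * => as_ _.
  by rewrite allF //= [all _ s](allT s) trivw // cs orbT.
by move=> as_ bs; rewrite !(allT s) IHs.
Qed.

(** In any listing one of [a] and [b] is above the other, and the added pair records which. *)
Lemma linsum_split R A a b f : uniq A -> a != b -> a \in A -> b \in A ->
  linsum R A f = linsum (addrel R a b) A f + linsum (addrel R b a) A f.
Proof.
move=> uA ab aA bA; rewrite /linsum.
rewrite (bigID (topdown (fun p q => (p == a) && (q == b)))) /=; congr (_ + _).
  apply: eq_bigl => s; rewrite /topdown -pairwise_relI.
  by apply: eq_pairwise => p q; rewrite negb_or.
rewrite big_seq_cond [RHS]big_seq_cond; apply: eq_bigl => s; rewrite mem_permutations.
case sA: (perm_eq s A) => //=.
rewrite /topdown not_before_xor ?(perm_uniq sA) ?(perm_mem sA) // negbK -pairwise_relI.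
by apply: eq_pairwise => p q; rewrite negb_or.
Qed.

Lemma linsumD R A f g : linsum R A (fun s => f s + g s) = linsum R A f + linsum R A g.
Proof. exact: big_split. Qed.

Lemma linsum_exchange R A S B (f : seq T -> seq T -> V) :
  linsum R A (fun s => linsum S B (f s)) =
  linsum S B (fun t => linsum R A (fun s => f s t)).
Proof. exact: exchange_big. Qed.

(** Linear extensions of a disjoint union are the shuffles of linear extensions of its parts; the
    induction removes the top element. *)
Lemma linsum_cat R B C f : uniq (B ++ C) ->
  (forall p q, p \in B -> q \in C -> ~~ R p q && ~~ R q p) ->
  linsum R (B ++ C) f =
  linsum R B (fun s => linsum R C (fun t => \sum_(u <- shuffles s t) f u)).
Proof.
have [n] := ubnP (size B + size C); elim: n => // n IHn in B C f *.
case: (eqVneq B [::]) => [-> _ _ _|B0].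
  by rewrite linsum_nil; apply: eq_linsum => // s _ _; rewrite big_seq1.
case: (eqVneq C [::]) => [-> _ _ _|C0].
  rewrite cats0; apply: eq_linsum => // s _ _.
  by rewrite linsum_nil shuffles_nilr big_seq1.
rewrite ltnS => szn uBC sep.
have uB : uniq B by move: uBC; rewrite cat_uniq => /andP[].
have uC : uniq C by move: uBC; rewrite cat_uniq => /and3P[].
have BC p : p \in C -> (p \in B) = false.
  by move: uBC; rewrite cat_uniq => /and3P[_ /hasPn H _] /H/negbTE.
(* Shuffles are sorted by whether their top element comes from [B] or from [C]. *)
pose top1 s t := if s is p :: s' then \sum_(u <- shuffles s' t) f (p :: u) else 0.
pose top2 s t := if t is q :: t' then \sum_(u <- shuffles s t') f (q :: u) else 0.
transitivity (linsum R B (fun s => linsum R C (top1 s)) +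
              linsum R C (fun t => linsum R B (top2^~ t))); last first.
  rewrite -(linsum_exchange R B R C top2) -linsumD; apply: eq_linsum => // s sB _.
  rewrite -linsumD; apply: eq_linsum => // t tC _.
  case: s sB => [|p s] sB; first by rewrite -size_eq0 -(perm_size sB) in B0.
  case: t tC => [|q t] tC; first by rewrite -size_eq0 -(perm_size tC) in C0.
  by rewrite shuffles_cons big_cat !big_map.
rewrite linsum_cons //; last by case: (B) B0.
rewrite big_cat /=; congr (_ + _); rewrite linsum_cons // big_seq_cond [RHS]big_seq_cond.
  apply: eq_big => [p|p /andP[pB _]].
    case pB: (p \in B) => //=; rewrite rem_cat pB all_cat.
    suff -> : all (fun q => ~~ R p q) C by rewrite andbT.
    by apply/allP => q qC; case/andP: (sep _ _ pB qC).
  rewrite rem_cat pB IHn // ?size_rem ?(perm_uniq (perm_to_rem pB)) //.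
  - by move: szn pB; case: (B) => // b B' /=; rewrite addSn.
  - apply: subseq_uniq uBC; apply: cat_subseq => //; exact: rem_subseq.
  - by move=> p' q /mem_rem p'B; exact: sep.
apply: eq_big => [q|q /andP[qC _]].
  case qC: (q \in C) => //=; rewrite rem_cat BC // all_cat.
  suff -> : all (fun p => ~~ R q p) B by [].
  by apply/allP => p pB; case/andP: (sep _ _ pB qC).
rewrite rem_cat BC // IHn ?size_rem //; first exact: linsum_exchange.
- by move: szn qC; case: (C) => // b B' /=; rewrite addnS.
- apply: subseq_uniq uBC; apply: cat_subseq => //; exact: rem_subseq.
- by move=> p q' pB /mem_rem; exact: sep.
Qed.

End LinearExtensionSums.

(** * Zigzag posets *)

Section Zigzags.
Variable T : eqType.
Implicit Types (c : seq T) (cs : seq (seq T)).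

(* p directly follows q in c. *)
Fixpoint adj c : rel T := fun p q =>
  if c is a :: c' then ((a == q) && (ohead c' == Some p)) || adj c' p q else false.

Definition linked c cs : rel T := fun p q =>
  if c is x :: c' then
    (if cs is (y :: _) :: _ then (p == last x c') && (q == y) else false)
  else false.

(* The chains of cs, each listed from the top down, where the bottom of each
   chain lies below the top of the next one. *)
Fixpoint zigzag cs : rel T := fun p q =>
  if cs is c :: cs' then [|| adj c p q, linked c cs' p q | zigzag cs' p q] else false.

Lemma adj_mem c p q : adj c p q -> (p \in c) && (q \in c).
Proof.
elim: c => [|a c IHc] //= /orP[/andP[/eqP<-]|/IHc/andP[pc qc]]; last first.
  by rewrite !inE pc qc !orbT.
by case: c {IHc} => [|b c] //= /eqP[<-]; rewrite !inE !eqxx orbT.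
Qed.

Lemma adj_cat x c y d p q : adj ((x :: c) ++ y :: d) p q =
  [|| adj (x :: c) p q, adj (y :: d) p q | (p == y) && (q == last x c)].
Proof.
elim: c x => [|z c IHc] x.
  rewrite [LHS]/= [adj [:: x] _ _]/= andbF orbC; congr (_ || _).
  by rewrite andbC [x == q]eq_sym (inj_eq Some_inj) [y == p]eq_sym.
have adjE e : adj [:: x, z & e] p q =
  ((x == q) && (Some z == Some p)) || adj (z :: e) p q by [].
by rewrite -[LHS]/(adj [:: x, z & c ++ y :: d] p q) !adjE -cat_cons IHc -orbA.
Qed.

Lemma adj_irr c p : uniq c -> adj c p p = false.
Proof.
elim: c => [|a c IHc] //= /andP[ac /IHc->]; rewrite orbF.
apply: contraNF ac => /andP[/eqP->]; case: c {IHc} => [|b c] //= /eqP[->].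
exact: mem_head.
Qed.

Lemma adj_sorted c : sorted (fun p q => adj c q p) c.
Proof.
elim: c => [|a [|b c] IHc] //; rewrite [sorted _ _]/= !eqxx /=.
apply: sub_path IHc => p q; rewrite /= => ->; exact: orbT.
Qed.

Lemma adj_topdown c : uniq c -> topdown (adj c) c.
Proof.
rewrite /topdown; elim: c => [|a c IHc] // /andP[ac uc]; rewrite pairwise_cons; apply/andP; split.
  apply/allP => q qc /=; rewrite negb_or; apply/andP; split.
    by apply: contra ac => /andP[/eqP->].
  by apply: contra ac => /adj_mem/andP[].
apply/(pairwiseP a) => i j; rewrite !inE => ic jc ij; rewrite /= negb_or.
have /(pairwiseP a)/(_ i j ic jc ij)-> := IHc uc; rewrite andbT; apply: contra ac => /andP[/eqP-> _].
exact: mem_nth.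
Qed.

Lemma adj_next x c p : p \in x :: c -> p != last x c -> exists q, adj (x :: c) q p.
Proof.
elim: c x => [|y c IHc] x; first by rewrite inE => ->.
rewrite inE => /orP[/eqP-> _|/IHc{}IHc]; first by exists y; rewrite /= !eqxx.
by case/IHc => q qp; exists q; rewrite [adj _ _ _]/= -/(adj (y :: c) q p) qp orbT.
Qed.

Lemma zigzag_mem cs p q : zigzag cs p q -> (p \in flatten cs) && (q \in flatten cs).
Proof.
elim: cs => [|c cs IHcs] //= /or3P[/adj_mem|L|/IHcs] /=; rewrite !mem_cat.
- by case/andP=> -> ->.
- case: c L => [|x c] //; case: cs {IHcs} => [|[|y d] cs] //= /andP[/eqP-> /eqP->].
  by rewrite mem_last mem_head orbT.
- by case/andP=> -> ->; rewrite !orbT.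
Qed.

Lemma adj_zigzag cs c p q : c \in cs -> adj c p q -> zigzag cs p q.
Proof.
elim: cs => [|d cs IHcs] //=; rewrite inE => /orP[/eqP<- ->//|/IHcs{}IHcs /IHcs->].
by rewrite !orbT.
Qed.

(** The bottom of the first chain lies below the top of the second in one summand and above it in
    the other, where the two chains join into one. Together these impose no relation, so the first
    chain is shuffled freely with the rest. *)
Lemma zigzag_merge (V : zmodType) x c y d cs (f : seq T -> V) :
    let A := flatten [:: x :: c, y :: d & cs] in uniq A ->
  linsum (zigzag [:: x :: c, y :: d & cs]) A f +
  linsum (zigzag ((x :: c ++ y :: d) :: cs)) A f =
  linsum (zigzag ((y :: d) :: cs)) (flatten ((y :: d) :: cs))
    (fun t => \sum_(u <- shuffles (x :: c) t) f u).
Proof.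
move=> A uA; pose R p q := adj (x :: c) p q || zigzag ((y :: d) :: cs) p q.
have disj p : p \in x :: c -> (p \in flatten ((y :: d) :: cs)) = false.
  move=> pc; apply: contraTF uA => pd.
  rewrite -[A]/((x :: c) ++ flatten ((y :: d) :: cs)) cat_uniq.
  by apply/and3P => -[_ /hasPn/(_ p pd)]; rewrite pc.
have lx : last x c \in x :: c by exact: mem_last.
have AE : A = (x :: c) ++ flatten ((y :: d) :: cs) by [].
have zF p q : (p \in x :: c) || (q \in x :: c) -> zigzag ((y :: d) :: cs) p q = false.
  by move=> pq; apply/negP => /zigzag_mem; case/orP: pq => /disj->; rewrite ?andbF.
have aF p q : (p \in flatten ((y :: d) :: cs)) || (q \in flatten ((y :: d) :: cs)) ->
    adj (x :: c) p q = false.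
  by move=> pq; apply/negP => /adj_mem/andP[/disj pd /disj qd]; rewrite pd qd in pq.
have E1 : linsum (zigzag [:: x :: c, y :: d & cs]) A f = linsum (addrel R (last x c) y) A f.
  apply: eq_linsum => // p q _ _; rewrite /addrel /R.
  rewrite -[LHS]/[|| adj (x :: c) p q, (p == last x c) && (q == y) | zigzag ((y :: d) :: cs) p q].
  by rewrite -orbA; congr (_ || _); rewrite orbC.
have E2 : linsum (zigzag ((x :: c ++ y :: d) :: cs)) A f = linsum (addrel R y (last x c)) A f.
  apply: eq_linsum => // p q _ _; rewrite /addrel /R.
  rewrite -[zigzag _ p q]/[|| adj ((x :: c) ++ y :: d) p q, linked ((x :: c) ++ y :: d) cs p q | zigzag cs p q].
  rewrite -[zigzag ((y :: d) :: cs) p q]/[|| adj (y :: d) p q, linked (y :: d) cs p q | zigzag cs p q].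
  rewrite adj_cat; have -> : linked ((x :: c) ++ y :: d) cs p q = linked (y :: d) cs p q.
    by rewrite /= last_cat.
  by move: (adj (x :: c) p q) (adj (y :: d) p q) (linked _ _ p q) (zigzag _ p q) (_ && _) => [] [] [] [] [].
rewrite {}E1 {}E2 -linsum_split //; first last.
- by rewrite AE !mem_cat mem_head orbT.
- by rewrite AE mem_cat lx.
- by apply: contraFneq (disj _ lx) => ->; rewrite /= mem_head.
rewrite AE linsum_cat //; last first.
  by move=> p q pc qd; rewrite /R !zF ?aF ?pc ?qd ?orbT.
have uc : uniq (x :: c) by move: uA; rewrite AE cat_uniq => /and3P[].
rewrite (@eq_linsum _ _ _ (adj (x :: c)) _ _ (fun s => linsum (zigzag ((y :: d) :: cs))
    (flatten ((y :: d) :: cs)) (fun t => \sum_(u <- shuffles s t) f u))).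
- by rewrite linsum_chain //; [exact: adj_sorted|exact: (adj_topdown uc)].
- by move=> p q pc _; rewrite /R zF ?pc // orbF.
by move=> s _ _; apply: eq_linsum => // p q pd _; rewrite /R aF ?pd.
Qed.

(** The last element of a listing has nothing below it, so it is the bottom of a chain. For the
    label y this keeps the words of the poset in [H1]. *)
Lemma zigzag_last (L : eqType) (delta : T -> L) b cs s : uniq (flatten cs) ->
    (forall c, c \in cs -> c != [::] /\ last b (map delta c) = b) ->
  perm_eq s (flatten cs) -> topdown (zigzag cs) s -> last b (map delta s) = b.
Proof.
move=> ucs csb; case/lastP: s => [|s p] //; rewrite map_rcons last_rcons => sA.
rewrite /topdown -cats1 pairwise_cat allrel1r => /and3P[/allP top _ _].
apply/eqP/negPn/negP => pb.
have : p \in flatten cs by rewrite -(perm_mem sA) mem_rcons mem_head.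
case/flattenP => -[//|x c] ccs pc; have [_ /= cb] := csb _ ccs.
have [|q qp] := @adj_next x c p pc.
  by apply: contra pb => /eqP->; rewrite -cb last_map.
have zqp := adj_zigzag ccs qp.
have : q \in flatten cs by case/andP: (zigzag_mem zqp).
rewrite -(perm_mem sA) mem_rcons inE => /orP[/eqP qE|/top]; last by rewrite zqp.
move: qp; rewrite {}qE adj_irr //; case/splitPr: ccs ucs => cs1 cs2.
rewrite flatten_cat cat_uniq => /and3P[_ _].
by rewrite -[flatten _]/((x :: c) ++ flatten cs2) cat_uniq => /and3P[].
Qed.
End Zigzags.

(** * Words of 2-posets as sums over listings *)

Section PosetWords.
Variables (d : Order.disp_t) (X : finPOrderType d).
Local Notation n := #|X|.

Lemma map_sort_injective (f : {ffun X -> 'I_n}) : injective f ->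
  map (fun p => f p : nat) (sort (fun p q => f p <= f q)%N (enum X)) = iota 0 n.
Proof.
move=> injf; pose g p : nat := f p; rewrite -[LHS](sort_map (f := g)).
have injg : injective g by move=> p q /val_inj /injf.
apply: (sorted_eq leq_trans anti_leq); first exact: sort_sorted leq_total _.
  exact: iota_sorted.
have ug : uniq (map g (enum X)) by rewrite map_inj_uniq ?enum_uniq.
rewrite perm_sort; apply: uniq_perm; rewrite ?iota_uniq //.
apply: (uniq_min_size ug _ _).2 => [_ /mapP[p _ ->]|].
  by rewrite mem_iota add0n /g ltn_ord.
by rewrite size_iota size_map -cardE.
Qed.

(** A monotone bijection amounts to the listing of the elements by decreasing value; words are read
    upwards, hence [rev]. *)
Lemma Wposet_linsum (delta : X -> letter) : Wposet delta =
  linsum (fun p q => (p < q)%O) (enum X) (fun s => word (rev (map delta s))).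
Proof.
pose srt (f : {ffun X -> 'I_n}) := sort (fun p q => f p <= f q)%N (enum X).
pose P (f : {ffun X -> 'I_n}) :=
  injectiveb f && [forall p, forall q, (p < q)%O ==> (f p < f q)%N].
have srtE (f : {ffun X -> 'I_n}) p0 i : injective f -> (i < n)%N -> f (nth p0 (srt f) i) = i :> nat.
  move=> injf ltin; have := map_sort_injective injf; rewrite -/(srt f) => fE.
  have szs : size (srt f) = n by rewrite size_sort -cardE.
  by rewrite -(nth_map p0 0%N (fun p => f p : nat)) ?szs // fE nth_iota.
have szs f : size (srt f) = n by rewrite size_sort -cardE.
rewrite /linsum -big_filter.
have permP : perm_eq [seq s <- permutations (enum X) | topdown (fun p q => (p < q)%O) s]
    [seq rev (srt f) | f <- enum P].
  apply: uniq_perm; first by rewrite filter_uniq ?permutations_uniq.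
    rewrite map_inj_in_uniq ?enum_uniq // => f g.
    rewrite !mem_enum => /andP[/injectiveP injf _] /andP[/injectiveP injg _] /(can_inj revK) fg.
    apply/ffunP => p; apply: val_inj; have pf : p \in srt f by rewrite mem_sort mem_enum.
    have ltin : (index p (srt f) < n)%N by rewrite -(szs f) index_mem.
    rewrite -(nth_index p pf) /=.
    by rewrite srtE // {2}fg srtE.
  move=> s; rewrite mem_filter mem_permutations; apply/andP/mapP => [[top sX]|[f]].
    have us : uniq (rev s) by rewrite rev_uniq (perm_uniq sX) enum_uniq.
    have szr : size (rev s) = n by rewrite size_rev (perm_size sX) cardE.
    have ms p : p \in rev s by rewrite mem_rev (perm_mem sX) mem_enum.
    have ltin p : (index p (rev s) < n)%N by rewrite -szr index_mem.
    pose f := [ffun p => Ordinal (ltin p)].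
    have injf : injective f.
      move=> p q; rewrite !ffunE => /(congr1 val) /= pq.
      by rewrite -(nth_index p (ms p)) pq nth_index.
    exists f; last first.
      apply: (can_inj revK); rewrite revK; apply: (inj_map (f := fun p => f p : nat)).
        by move=> p q /val_inj /injf.
      rewrite map_sort_injective //; apply: (@eq_from_nth _ 0%N).
        by rewrite size_map size_iota.
      move=> i; rewrite size_map szr => ltin'; rewrite nth_iota //.
      have p0 : X by move: (ltin'); rewrite -szr; case: (rev s).
      by rewrite (nth_map p0) ?szr // ffunE /= index_uniq ?szr.
    rewrite mem_enum; apply/andP; split; first exact/injectiveP.
    apply/forallP => p; apply/forallP => q; apply/implyP => pq; rewrite !ffunE /=.
    case: ltngtP => // [qp|/(congr1 (nth p (rev s)))]; last first.
      by rewrite !nth_index // => pqE; rewrite pqE ltxx in pq.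
    have : pairwise (fun p q => ~~ (q < p)%O) (rev s).
      by move: top; rewrite /topdown; elim: (s) => [|a t IHt] //=;
         rewrite rev_cons pairwise_rcons all_rev => /andP[-> /IHt].
    move/(pairwiseP p)/(_ _ _ _ _ qp); rewrite !inE szr !ltin => /(_ isT isT).
    by rewrite !nth_index // pq.
  rewrite mem_enum => /andP[/injectiveP injf /forallP mono] ->; split; last first.
    by rewrite perm_rev perm_sort.
  have : pairwise (fun p q => ~~ (q < p)%O) (srt f).
    case: (pickP X) => [p0 _|X0]; last by case: (srt f) => // p; have := X0 p.
    apply/(pairwiseP p0) => i j; rewrite !inE szs => ltin ltjn ltij.
    apply/negP => ji; have /forallP/(_ (nth p0 (srt f) i))/implyP/(_ ji) := mono (nth p0 (srt f) j).
    by rewrite !srtE // ltnNge ltnW.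
  rewrite /topdown; elim: (srt f) => [|a t IHt] //= /andP[at_ /IHt].
  by rewrite rev_cons pairwise_rcons all_rev at_.
rewrite (perm_big _ permP) big_map big_enum; apply: eq_bigr => f _.
by rewrite map_rev revK.
Qed.

End PosetWords.

Lemma linsum_map (T U : eqType) (V : zmodType) (g : T -> U) (R : rel U) A (f : seq U -> V) :
  injective g -> uniq A ->
  linsum R (map g A) f = linsum (fun p q => R (g p) (g q)) A (fun s => f (map g s)).
Proof.
move=> injg; have rem_map (B : seq T) p : rem (g p) (map g B) = map g (rem p B).
  by elim: B => [|b B IHB] //=; rewrite (inj_eq injg) IHB; case: ifP.
have [m] := ubnP (size A); elim: m A f => // m IHm A f szA uA.
case: (eqVneq A [::]) => [->|A0]; first by rewrite !linsum_nil.
rewrite !linsum_cons // ?map_inj_uniq //; last by case: (A) A0.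
rewrite big_map big_seq_cond [RHS]big_seq_cond; apply: eq_big => p.
  by case: (p \in A) => //=; rewrite rem_map all_map.
case/andP=> pA _; rewrite rem_map IHm ?rem_uniq // size_rem //.
by case: (A) szA A0.
Qed.

(* The word of an index read backwards; [rword l] is therefore the reverse of
   the word of [rev l]. *)
Definition rword (l : seq nat) : seq letter :=
  flatten [seq rcons (nseq a.-1 lx) ly | a <- l].

Lemma rword_cons a l : rword (a :: l) = rcons (nseq a.-1 lx) ly ++ rword l.
Proof. by []. Qed.

Lemma rword_cat l l' : rword (l ++ l') = rword l ++ rword l'.
Proof. by rewrite /rword map_cat flatten_cat. Qed.

Lemma last_rword l : last ly (rword l) = ly.
Proof. by elim: l => [|a l IHl] //; rewrite rword_cons last_cat last_rcons. Qed.

Lemma zmon_rev l : zmon (rev l) = word (rev (rword l)).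
Proof.
rewrite zmonE; congr word; elim: l => [|a l IHl] //.
rewrite rev_cons map_rcons flatten_rcons IHl rword_cons rev_cat rev_rcons; congr (_ ++ _ :: _).
by rewrite rev_nseq.
Qed.

Lemma rwordP (v : seq letter) : last ly v = ly -> exists2 l, is_index l & v = rword l.
Proof.
have [m] := ubnP (size v); elim: m v => // m IHm [|[] v] /=; first by exists [::].
  rewrite ltnS => szv /(IHm _ szv)[l lP ->]; by exists (1%N :: l).
rewrite ltnS => szv lv; have [|[|a l] lP vE] := IHm v szv.
- by case: v lv {szv}.
- by rewrite vE in lv.
by case: a lP vE => // a lP ->; exists (a.+2 :: l).
Qed.

Definition letter_at (p : nat * nat) : letter := if p.2 == 0%N then ly else lx.

(** Pairs of naturals replace the dependent type [xstar k], so that rows can be split off by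
    recursion on the index. *)
Definition chain (i a : nat) : seq (nat * nat) := [seq (i, m) | m <- rev (iota 0 a)].

Fixpoint chains (i : nat) (k : seq nat) : seq (seq (nat * nat)) :=
  if k is a :: k' then chain i a :: chains i.+1 k' else [::].

Lemma chainS i a : chain i a.+1 = (i, a) :: chain i a.
Proof. by rewrite /chain -addn1 iotaD cats1 rev_rcons. Qed.

Lemma mem_chain i a p : (p \in chain i a) = (p.1 == i) && (p.2 < a)%N.
Proof.
case: p => j m; rewrite -[m in RHS](add0n m); apply/mapP/andP => [[m' m'a [-> ->]]|[/eqP<- ma]].
  by move: m'a; rewrite mem_rev mem_iota eqxx.
by exists m => //; rewrite mem_rev mem_iota.
Qed.

Lemma uniq_chain i a : uniq (chain i a).
Proof. by rewrite map_inj_uniq ?rev_uniq ?iota_uniq // => m m' []. Qed.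

Lemma last_chain i a x : last x (chain i a.+1) = (i, 0%N).
Proof. by elim: a x => [|a IHa] x //; rewrite chainS [LHS]IHa. Qed.

Lemma map_chain i a : map letter_at (chain i a.+1) = rword [:: a.+1].
Proof.
rewrite /rword /= cats0; elim: a => [|a IHa] //.
by rewrite chainS map_cons IHa.
Qed.

Lemma adj_chain i a p q : adj (chain i a) p q =
  [&& p.1 == i, q.1 == i, q.2 == p.2.+1 & (q.2 < a)%N].
Proof.
case: p q => [j m] [j' m'] /=; elim: a => [|a IHa]; first by rewrite ltn0 !andbF.
rewrite chainS [LHS]/= IHa ltnS (leq_eqVlt m' a) !andb_orr; congr (_ || _).
rewrite xpair_eqE; case: a {IHa} => [|a].
  by rewrite andbF; apply/esym/negP => /and4P[_ _ /eqP->].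
rewrite chainS /= (inj_eq Some_inj) xpair_eqE [i == j]eq_sym [i == j']eq_sym [a.+1 == _]eq_sym [a == _]eq_sym.
case: (j == i); case: (j' == i); rewrite //= ?andbF //.
by case: (eqVneq m' a.+1) => [->|]; rewrite ?andbF //= eqSS eq_sym andbT.
Qed.

Lemma mem_chains i k p : (p \in flatten (chains i k)) =
  [&& i <= p.1, p.1 < i + size k & p.2 < nth 0 k (p.1 - i)]%N.
Proof.
elim: k i => [|a k IHk] i /=; first by rewrite in_nil; apply/esym/negP => /and3P[]; lia.
rewrite mem_cat mem_chain IHk; case: (ltngtP p.1 i) => [pi|ip|->] /=.
- by [].
- rewrite addnS -addSn; have -> : (p.1 - i)%N = (p.1 - i.+1).+1 by lia.
  by [].
- by rewrite subnn addnS ltnS leq_addr orbF.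
Qed.

Lemma uniq_chains i k : uniq (flatten (chains i k)).
Proof.
elim: k i => [|a k IHk] i //=; rewrite cat_uniq IHk uniq_chain andbT /=.
by apply/hasPn => p; rewrite mem_chains mem_chain => /andP[ip _]; rewrite gtn_eqF.
Qed.

(** The right-hand side is [xstar_gen] in coordinates, with the first row numbered [i]. *)
Lemma zigzag_chains i k p q : is_index k ->
    p \in flatten (chains i k) -> q \in flatten (chains i k) ->
  zigzag (chains i k) p q = ((q.1 == p.1) && (q.2 == p.2.+1)) ||
    [&& q.1 == p.1.+1, p.2 == 0%N & q.2.+1 == nth 0%N k (q.1 - i)].
Proof.
elim: k i => [|a k IHk] i // /andP[a0 kP].
case: a a0 => // a _; rewrite -[chains i _]/(chain i a.+1 :: chains i.+1 k).
rewrite [flatten _]/(_ ++ flatten (chains i.+1 k)) !mem_cat !mem_chain.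
rewrite -[zigzag _ p q]/[|| adj (chain i a.+1) p q, linked (chain i a.+1) (chains i.+1 k) p q | zigzag (chains i.+1 k) p q].
have -> : linked (chain i a.+1) (chains i.+1 k) p q =
    [&& k != [::], p == (i, 0%N) & q == (i.+1, (head 0%N k).-1)].
  case: k kP {IHk} => [|b k]; [by rewrite chainS | case/andP=> b0 _].
  case: b b0 => // b _; rewrite chainS -[chains _ _]/(chain i.+1 b.+1 :: _) chainS /=.
  by case: a => [|a] //=; rewrite last_chain.
have memF r : (r.1 <= i)%N -> (r \in flatten (chains i.+1 k)) = false.
  by move=> ri; rewrite mem_chains ltnNge ri.
have memP r : (r.1 == i) && (r.2 < a.+1)%N || (r \in flatten (chains i.+1 k)) ->
    (r.1 == i) && (r.2 < a.+1)%N \/ (i < r.1)%N /\ r \in flatten (chains i.+1 k).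
  case/orP=> [->|rk]; [by left | right; split=> //].
  by move: rk; rewrite mem_chains => /and3P[].
have zzF : (p.1 <= i)%N || (q.1 <= i)%N -> zigzag (chains i.+1 k) p q = false.
  move=> pq; apply/negP => /zigzag_mem.
  by case/orP: pq => /memF->; rewrite ?andbF.
rewrite adj_chain; case: p q IHk memF zzF => [j m] [j' m'] /= IHk memF zzF.
rewrite !xpair_eqE => /memP/= [/andP[/eqP ji ma]|[ij pk]] /memP/= [/andP[/eqP ji' m'a]|[ij' qk]].
- rewrite zzF ji ?leqnn // ji' !eqxx m'a (ltn_eqF (ltnSn i)) !andbF /= andbT; by case: eqP.
- rewrite zzF ji ?leqnn // eqxx (gtn_eqF ij') /= orbF; case: (eqVneq j' i.+1) => [j'E|]; last by rewrite !andbF.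
  move: qk; rewrite j'E mem_chains /= subnn subSnn leqnn /= => /andP[_].
  case: k kP {IHk memP memF zzF} => [|[|b] k] //= _.
- by rewrite zzF ji' ?leqnn ?orbT // !(gtn_eqF ij) (ltn_eqF ij) ?andbF ?(ltn_eqF (leqW ij)).
- rewrite (gtn_eqF ij) /= IHk // !andbF /=.
  have -> : (j' - i = (j' - i.+1).+1)%N by lia.
  by [].
Qed.

(** In a listing that respects the generating relations, positions decrease along every path, so the
    generated order is respected too. *)
Lemma topdown_connect (T : finType) (R : rel T) (s : seq T) :
    (forall p q, connect R p q -> connect R q p -> p = q) -> (forall p, ~~ R p p) ->
    uniq s -> (forall p, p \in s) ->
  topdown (fun p q => (p != q) && connect R p q) s = topdown R s.
Proof.
move=> anti irr us sT; apply/idP/idP.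
  apply: sub_pairwise => p q; apply: contra => pq; rewrite connect1 // andbT.
  by apply: contraTneq pq => ->.
case: s us sT => // x0 s0; move: (x0 :: s0) => s us sT.
move=> /(pairwiseP x0) top; apply/(pairwiseP x0) => i j; rewrite !inE => si sj ij.
have step p q : R p q -> (index q s < index p s)%N.
  move=> pq; rewrite ltnNge leq_eqVlt; apply/norP; split.
    apply: contraTneq pq => /(congr1 (nth x0 s)); rewrite !nth_index // => ->.
    exact: irr.
  apply: contraTN pq => /(top _ _ _ _); rewrite !inE !index_mem !nth_index //.
  exact.
have mono p q : connect R p q -> (index q s <= index p s)%N.
  case/connectP=> t; elim: t p => [|r t IHt] p /=; first by move=> _ ->.
  by case/andP=> /step pr rt qE; apply: leq_trans (IHt _ rt qE) (ltnW pr).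
by apply/andP => -[_ /mono]; rewrite !index_uniq // leqNgt ij.
Qed.

Section StarWords.
Variable k : seq nat.
Hypothesis k_index : is_index k.

Definition xstar_pair (p : xstar k) : nat * nat := (xstar_row p, xstar_pos p).

Lemma xstar_pair_inj : injective xstar_pair.
Proof.
case=> i m [j m'] []; rewrite /xstar_row /xstar_pos /= => /val_inj ij; move: m m'.
by rewrite ij => m m' /val_inj ->.
Qed.

Lemma xstar_pair_enum :
  perm_eq [seq xstar_pair p | p <- enum {: xstar k}] (flatten (chains 0 k)).
Proof.
have inchain p : xstar_pair p \in flatten (chains 0 k).
  by case: p => i m; rewrite mem_chains /= /xstar_row /xstar_pos /= subn0 !ltn_ord.
apply: uniq_perm; first by rewrite map_inj_uniq ?enum_uniq //; exact: xstar_pair_inj.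
  exact: uniq_chains.
move=> p; apply/mapP/idP => [[q _ ->] //|].
rewrite mem_chains subn0 => /and3P[_ ik mk].
exists (existT (fun i : 'I_(size k) => 'I_(nth 0%N k i)) (Ordinal ik) (Ordinal mk)).
  by rewrite mem_enum.
by case: p ik mk.
Qed.

Lemma wstar_linsum : wstar k = linsum (zigzag (chains 0 k)) (flatten (chains 0 k))
  (fun s => word (rev (map letter_at s))).
Proof.
rewrite -(perm_linsum _ _ xstar_pair_enum) linsum_map ?enum_uniq //; last exact: xstar_pair_inj.
rewrite /wstar Wposet_linsum /linsum big_seq_cond [RHS]big_seq_cond.
have gen_irr (p : xstar k) : ~~ xstar_gen p p.
  by apply/negP => /xstar_gen_rank; rewrite ltnn.
apply: eq_big => [s|s _]; last first.
  by rewrite -map_comp; congr (word (rev _)); apply: eq_map => p.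
rewrite mem_permutations; case sX: (perm_eq s _) => //=.
transitivity (topdown (@xstar_gen k) s).
  rewrite -[RHS]topdown_connect //.
  - by apply: eq_pairwise => p q; rewrite lt_neqAle.
  - by move=> p q pq qp; apply: xstar_le_anti; rewrite /xstar_le pq qp.
  - by rewrite (perm_uniq sX) enum_uniq.
  - by move=> p; rewrite (perm_mem sX) mem_enum.
have chp p : xstar_pair p \in flatten (chains 0 k).
  by rewrite -(perm_mem xstar_pair_enum) map_f // mem_enum.
by apply: eq_pairwise => p q; rewrite zigzag_chains // subn0.
Qed.

End StarWords.

(** * The recursion for zigzag posets *)

Section StarRecursion.
Variables (R : comNzRingType) (phi : seq letter -> R).
Hypothesis phiM : forall v w, last ly v = ly -> last ly w = ly ->
  phi v * phi w = \sum_(u <- shuffles v w) phi u.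
Hypothesis phi_nil : phi [::] = 1.

Let s l := phi (rword l).

(** The value of the zigzag whose first chain has word [rword l] and whose other chains belong to
    the entries of [t]. The recursion is [zigzag_merge], with the free shuffle turned into a product
    by [phiM]. *)
Fixpoint zigzag_value (l t : seq nat) : R :=
  if t is b :: t' then s l * zigzag_value [:: b] t' - zigzag_value (rcons l b) t'
  else s l.

Definition star_value (k : seq nat) : R :=
  if k is a :: t then zigzag_value [:: a] t else 1.

(** Since s l times [star_value (b :: t)] equals [zigzag_value l (b :: t)] plus
    [zigzag_value (rcons l b) t], the alternating sum over deconcatenations telescopes. *)
Lemma conv_star_value k : conv s (signed star_value) k = conv1 R k.
Proof.
have C l t : conv (fun u => s (l ++ u)) (signed star_value) t =
    if t is _ :: _ then (-1) ^+ size t * zigzag_value l t else s l.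
  elim: t l => [|b t IHt] l; first by rewrite /= cats0 /signed /= !mulr1 addr0.
  rewrite [LHS]/= cats0.
  rewrite (@eq_conv _ _ (fun u => s (rcons l b ++ u)) _ (signed star_value)) //; last first.
    by move=> u; rewrite cat_rcons.
  rewrite IHt /signed [size _]/= exprS; case: t {IHt} => [|c t] /=; first by rewrite expr0; ring.
  by rewrite !exprS; ring.
case: k => [|a t]; first by rewrite /= /s /signed /= phi_nil expr0 !mul1r addr0.
rewrite [LHS]/= /s /= phi_nil mul1r -/s.
rewrite (@eq_conv _ _ (fun u => s ([:: a] ++ u)) _ (signed star_value)) // C.
by rewrite /signed; case: t => [|b t] /=; rewrite ?exprS ?expr0 ?conv1 /conv1 /=; ring.
Qed.

Lemma linsum_zigzag_value (T : eqType) (delta : T -> letter) c cs l t :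
    uniq (flatten (c :: cs)) -> (0 < size l)%N ->
    map delta c = rword l -> map (map delta) cs = [seq rword [:: b] | b <- t] ->
  linsum (zigzag (c :: cs)) (flatten (c :: cs)) (fun u => phi (map delta u)) =
  zigzag_value l t.
Proof.
elim: t c cs l => [|b t IHt] c [|d cs] l // ucs l0 cl.
  move=> _; rewrite /= cats0 /s -cl in ucs *.
  rewrite (@eq_linsum _ _ _ (adj c) _ _ (fun u => phi (map delta u))) //.
    by rewrite linsum_chain //; [exact: adj_sorted|exact: adj_topdown].
  move=> p q _ _; rewrite -[LHS]/[|| adj c p q, linked c [::] p q | false].
  by have -> : linked c [::] p q = false; rewrite ?orbF //; case: (c).
case=> db csb.
have ud : uniq (flatten (d :: cs)).
  by move: ucs; rewrite -[flatten _]/(c ++ flatten (d :: cs)) cat_uniq => /and3P[].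
have rw0 a m : rword (a :: m) != [::] by rewrite -size_eq0 rword_cons size_cat size_rcons.
have cd : map delta (c ++ d) = rword (rcons l b) by rewrite map_cat cl db -cats1 rword_cat.
rewrite -[RHS]/(s l * zigzag_value [:: b] t - zigzag_value (rcons l b) t).
have := IHt (c ++ d) cs (rcons l b); rewrite -[flatten _]/((c ++ d) ++ flatten cs) -catA.
move/(_ ucs); rewrite size_rcons => /(_ isT cd csb) <-.
rewrite -(IHt d cs [:: b] ud isT db csb).
case: c ucs cl cd => [|x c] ucs cl cd; first by case: (l) l0 cl => // a m _ /eqP; rewrite eq_sym (negbTE (rw0 _ _)).
case: d db ud ucs cd => [|y d] db ud ucs cd; first by move/eqP: db; rewrite eq_sym (negbTE (rw0 _ _)).
apply/eqP; rewrite eq_sym subr_eq; apply/eqP; symmetry.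
rewrite [LHS](zigzag_merge _ ucs) /linsum mulr_sumr big_seq_cond [RHS]big_seq_cond.
apply: eq_bigr => u; rewrite mem_permutations => /andP[uA utop].
rewrite /s -cl phiM; first by rewrite shuffles_map big_map.
  by rewrite cl last_rword.
apply: (@zigzag_last _ _ _ ly ((y :: d) :: cs)) => // e; rewrite inE => ecs.
have [m [m0 em]] : exists a, e != [::] /\ map delta e = rword [:: a].
  case/predU1P: ecs => [->|/(map_f (map delta))]; first by exists b.
  rewrite csb => /mapP[a _ ea]; exists a; split=> //.
  by apply/eqP => e0; move/eqP: ea; rewrite e0 eq_sym (negbTE (rw0 _ _)).
by rewrite em last_rword.
Qed.

Lemma star_value_wstar k : is_index k ->
  linsum (zigzag (chains 0 k)) (flatten (chains 0 k)) (fun u => phi (map letter_at u)) =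
  star_value k.
Proof.
case: k => [|a t] kP; first by rewrite linsum_nil phi_nil.
have map1 i b : (0 < b)%N -> map letter_at (chain i b) = rword [:: b].
  by case: b => // b _; exact: map_chain.
case/andP: kP => a0 tP.
have mapch i : map (map letter_at) (chains i t) = [seq rword [:: b] | b <- t].
  elim: t tP i => [|b t IHt] // /andP[b0 tP] i.
  by rewrite -[chains i _]/(chain i b :: chains i.+1 t) !map_cons map1 // IHt.
by apply: linsum_zigzag_value; rewrite ?map1 //; exact: (uniq_chains 0 (a :: t)).
Qed.
End StarRecursion.

(** * Regularized values *)

Lemma shuffle_rev_shuffles (v w : seq letter) :
  shuffle_rev v w = \sum_(u <- shuffles v w) word (rev u).
Proof.
elim: v w => [|a v IHv] w; first by rewrite big_seq1.
elim: w => [|b w IHw]; first by rewrite big_seq1.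
rewrite shuffles_cons big_cat !big_map.
rewrite -[LHS]/(shuffle_rev v (b :: w) * word [:: a] + shuffle_rev (a :: v) w * word [:: b]).
rewrite IHv IHw !mulr_suml; congr (_ + _); apply: eq_bigr => u _;
  by rewrite -word_cat rev_cons cats1.
Qed.

Lemma last_shuffles (T : eqType) (c : T) (v w u : seq T) : u \in shuffles v w ->
  last c v = c -> last c w = c -> last c u = c.
Proof.
elim: v w u => [|a v IHv] w u; first by rewrite inE => /eqP->.
elim: w u => [|b w IHw] u; first by rewrite inE => /eqP->.
have last_tl (x : T) (t : seq T) : last c (x :: t) = c -> last c t = c.
  by case: t => [|y t] //= ->.
rewrite shuffles_cons mem_cat => /orP[] /mapP[t tP ->] av bw.
  have := IHv _ _ tP (last_tl _ _ av) bw; case: t tP => // /size_shuffles /=; lia.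
have := IHw _ tP av (last_tl _ _ bw); case: t tP => // /size_shuffles /=; lia.
Qed.

Section Regularization.
Variables (R : realType) (Zsh : hoffman -> {poly R}).
Hypothesis Zsh_reg : is_shuffle_regularization Zsh.

(** Words are reversed so that the last letters, on which the shuffle recursion acts, come first.
    Evaluation at T = 0 preserves products. *)
Definition phi (w : seq letter) : R := (Zsh (word (rev w))).[0].

Lemma H1_word w : last ly w = ly -> H1 (word (rev w)).
Proof.
case/lastP: w => [|w u] /=; first by exists 1, 0; rewrite word_nil mulr0 addr0 scale1r.
rewrite last_rcons => ->; exists 0, (word (rev w)).
by rewrite rev_rcons scale0r add0r -word_cat.
Qed.

Lemma H1_0 : H1 0.
Proof. by exists 0, 0; rewrite mulr0 addr0 scale0r. Qed.

Lemma H1D g h : H1 g -> H1 h -> H1 (g + h).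
Proof.
move=> [q [g' ->]] [r [h' ->]]; exists (q + r), (g' + h').
by rewrite mulrDr scalerDl addrACA.
Qed.

Lemma Zsh_sum (I : eqType) (s : seq I) (F : I -> hoffman) :
  (forall i, i \in s -> H1 (F i)) -> Zsh (\sum_(i <- s) F i) = \sum_(i <- s) Zsh (F i).
Proof.
have Zsh0 : Zsh 0 = 0.
  by have := Zsh_scale Zsh_reg 0 H1_0; rewrite scale0r rmorph0 scale0r.
elim: s => [|i s IHs] sH; first by rewrite !big_nil.
have sH' j : j \in s -> H1 (F j) by move=> js; apply: sH; rewrite inE js orbT.
rewrite !big_cons (Zsh_add Zsh_reg) ?IHs //; first by apply: sH; rewrite mem_head.
rewrite big_seq; elim/big_rec: _ => [|j g js]; [exact: H1_0 | exact: H1D (sH' _ js)].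
Qed.

Lemma phi_shuffle v w : last ly v = ly -> last ly w = ly ->
  phi v * phi w = \sum_(u <- shuffles v w) phi u.
Proof.
move=> vy wy; rewrite /phi -hornerM -(Zsh_shuffle Zsh_reg); [|exact: H1_word..].
rewrite shuffleE /shuffle_word !revK shuffle_rev_shuffles Zsh_sum ?horner_sum //.
by move=> u uP; apply: H1_word; apply: last_shuffles uP vy wy.
Qed.

Lemma phi_nil : phi [::] = 1.
Proof. by rewrite /phi word_nil (Zsh_one Zsh_reg) hornerC. Qed.

Lemma phi_y : phi [:: ly] = 0.
Proof. by rewrite /phi (Zsh_y Zsh_reg) hornerX. Qed.

Lemma zeta_sh_rev l : zeta_sh Zsh (rev l) = phi (rword l).
Proof. by rewrite /zeta_sh zmon_rev. Qed.

Lemma zeta_star_KYE k : is_index k -> zeta_star_KY Zsh k = star_value phi k.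
Proof.
move=> kP; rewrite -(star_value_wstar phi_shuffle phi_nil kP).
rewrite /zeta_star_KY wstar_linsum // /linsum -big_filter Zsh_sum.
  by rewrite horner_sum big_filter.
move=> s; rewrite mem_filter mem_permutations => /andP[top sA]; apply: H1_word.
apply: (zigzag_last _ _ sA top) => [|c].
  exact: uniq_chains.
move: (0%N); elim: (k) kP => [|[|a] t IHt] //= tP i.
rewrite inE => /predU1P[->|/IHt]; last exact.
by rewrite map_chain last_rword chainS.
Qed.

Lemma H0_word v : last lx v = ly -> H0 (word (rev (lx :: v))).
Proof.
case/lastP: v => [|v u] //; rewrite last_rcons => ->; exists 0, (word (rev v)).
by rewrite scale0r add0r rev_cons rev_rcons -cats1 word_cat -[_ :: _]cat1s word_cat.
Qed.

Lemma rword_head2 a t : (1 < a)%N ->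
  exists2 v, rword (a :: t) = lx :: v & last lx v = ly.
Proof.
case: a => [|[|a]] // _; exists (rcons (nseq a lx) ly ++ rword t) => //.
by rewrite last_cat last_rcons last_rword.
Qed.

Lemma phi_admissible a t : is_index (a :: t) -> (1 < a)%N ->
  phi (rword (a :: t)) = zeta R (rev (a :: t)).
Proof.
move=> lP a1; rewrite -zeta_sh_rev /zeta_sh (Zsh_extends Zsh_reg).
  by rewrite hornerC Zmap_zmon // /is_index all_rev.
by have [v vE vy] := rword_head2 t a1; rewrite zmon_rev vE; exact: H0_word.
Qed.

End Regularization.

(** The j + 1 places before the x all give the same word; the other insertions fall behind it. *)
Lemma sum_shuffles_y (V : zmodType) (f : seq letter -> V) j v :
  \sum_(u <- shuffles (nseq j ly ++ lx :: v) [:: ly]) f u =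
  f (nseq j.+1 ly ++ lx :: v) *+ j.+1 +
  \sum_(w <- shuffles v [:: ly]) f (nseq j ly ++ lx :: w).
Proof.
elim: j f => [|j IHj] f.
  by rewrite shuffles_cons big_cat !big_map shuffles_nilr big_seq1 addrC.
rewrite -[nseq j.+1 ly ++ _]/(ly :: nseq j ly ++ lx :: v) shuffles_cons big_cat !big_map.
rewrite shuffles_nilr big_seq1 IHj [RHS](congr1 (+%R^~ _) (mulrSr _ _)).
exact: addrAC.
Qed.

Lemma sum_shuffles_ones (V : zmodType) (f : seq letter -> V) j :
  \sum_(u <- shuffles (nseq j ly) [:: ly]) f u = f (nseq j.+1 ly) *+ j.+1.
Proof.
elim: j f => [|j IHj] f; first by rewrite big_seq1.
rewrite -[nseq j.+1 ly]/(ly :: nseq j ly) shuffles_cons big_cat !big_map.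
by rewrite shuffles_nilr big_seq1 IHj [RHS]mulrSr.
Qed.

Lemma index_split l : is_index l ->
  exists j r, [/\ l = nseq j 1%N ++ r, is_index r & if r is a :: _ then (1 < a)%N else true].
Proof.
elim: l => [|[|[|a]] l IHl] //; first by exists 0%N, [::].
  by case/IHl => j [r [-> rP r1]]; exists j.+1, r.
by move=> lP; exists 0%N, (a.+2 :: l).
Qed.

Lemma rword_ones j : rword (nseq j 1%N) = nseq j ly.
Proof. by elim: j => //= j IHj; rewrite rword_cons IHj. Qed.

(** * The ring of multiple zeta values *)

Section Span.
Variables (R : realType).

Lemma mzv_span0 : mzv_span (0 : R).
Proof. by exists [::]; rewrite ?big_nil. Qed.

Lemma mzv_spanD (a b : R) : mzv_span a -> mzv_span b -> mzv_span (a + b).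
Proof.
move=> [s sP ->] [t tP ->]; exists (s ++ t); first by rewrite all_cat sP.
by rewrite big_cat.
Qed.

Lemma mzv_spanZ (q : rat) (a : R) : mzv_span a -> mzv_span (ratr q * a).
Proof.
move=> [s sP ->]; exists [seq (q * p.1, p.2) | p <- s]; first by rewrite all_map.
by rewrite big_map mulr_sumr; apply: eq_bigr => p _; rewrite rmorphM mulrA.
Qed.

Lemma mzv_spanN (a : R) : mzv_span a -> mzv_span (- a).
Proof. by move/(mzv_spanZ (-1)); rewrite rmorphN1 mulN1r. Qed.

Lemma mzv_span_sum (I : eqType) (s : seq I) (F : I -> R) :
  (forall i, i \in s -> mzv_span (F i)) -> mzv_span (\sum_(i <- s) F i).
Proof.
move=> sF; rewrite big_seq; elim/big_rec: _ => [|i x iS]; first exact: mzv_span0.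
exact: mzv_spanD (sF _ iS).
Qed.

Lemma mzv_span_zeta k : admissible k -> mzv_span (zeta R k).
Proof.
by move=> kP; exists [:: (1, k)]; rewrite ?big_seq1 /= ?kP // rmorph1 mul1r.
Qed.

Variable Zsh : hoffman -> {poly R}.
Hypothesis Zsh_reg : is_shuffle_regularization Zsh.
Local Notation phi := (phi Zsh).

Lemma zeta_nil : zeta R [::] = 1.
Proof.
rewrite -(@Zmap_zmon R [::]) // /zmon big_nil.
have /polyC_inj -> // : (Zmap R 1)%:P = 1%:P.
rewrite -(Zsh_extends Zsh_reg) ?(Zsh_one Zsh_reg) //.
by exists 1, 0; rewrite mulr0 mul0r addr0 scale1r.
Qed.

Lemma mzv_span1 : mzv_span (1 : R).
Proof. by rewrite -zeta_nil; exact: mzv_span_zeta. Qed.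

Lemma phi_x_span v : last lx v = ly -> mzv_span (phi (lx :: v)).
Proof.
move=> vy; have [|l lP vE] := @rwordP (lx :: v); first by rewrite -vy; case: (v) vy.
case: l lP vE => [|a t] // tP vE.
have a1 : (1 < a)%N by case: a tP vE => [|[|a]].
rewrite vE (phi_admissible Zsh_reg tP a1); apply: mzv_span_zeta.
rewrite /admissible /is_index all_rev -/(is_index _) tP /= rev_cons last_rcons.
by rewrite a1 orbT.
Qed.

Lemma last_lx v : v != [::] -> last lx v = last ly v.
Proof. by case: v. Qed.

(** A shuffle of two words that begin with x and end with y is again of this kind, so no divergent
    word occurs in the product. *)
Lemma phi_mul_span v w : last lx v = ly -> last lx w = ly ->
  mzv_span (phi (lx :: v) * phi (lx :: w)).
Proof.
have y1 u : last lx u = ly -> last ly (lx :: u) = ly by [].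
move=> vy wy; rewrite (phi_shuffle Zsh_reg) ?y1 //; apply: mzv_span_sum => u uP.
have := last_shuffles uP (y1 _ vy) (y1 _ wy).
by move: uP; rewrite shuffles_cons mem_cat => /orP[] /mapP[t _ ->] /phi_x_span.
Qed.

Lemma zeta_phi k : admissible k -> zeta R k = 1 \/
  exists2 v, last lx v = ly & zeta R k = phi (lx :: v).
Proof.
case/andP; case/lastP: k => [_ _|k a]; first by left; exact: zeta_nil.
rewrite last_rcons -size_eq0 size_rcons /= => kP a1; right.
have [v vE vy] := rword_head2 (rev k) a1; exists v => //.
by rewrite -vE (phi_admissible Zsh_reg) ?rev_cons ?revK // /is_index -rev_rcons all_rev.
Qed.

Lemma mzv_spanM (a b : R) : mzv_span a -> mzv_span b -> mzv_span (a * b).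
Proof.
move=> [s sP ->] [t tP ->]; rewrite mulr_suml; apply: mzv_span_sum => p ps.
rewrite mulr_sumr; apply: mzv_span_sum => q qt.
rewrite mulrACA -rmorphM; apply: mzv_spanZ.
have pP := allP sP _ ps; have qP := allP tP _ qt.
case: (zeta_phi pP) => [->|[v vy pE]]; first by rewrite mul1r; exact: mzv_span_zeta.
case: (zeta_phi qP) => [->|[w wy ->]]; first by rewrite mulr1; exact: mzv_span_zeta.
by rewrite pE; exact: phi_mul_span.
Qed.

(* [phi] kills every shuffle with the letter y, so the leading y's of a
   reversed word can be moved inwards one at a time. *)
Lemma phi_y_cat j v : last lx v = ly -> phi (nseq j.+1 ly ++ lx :: v) =
  - (j.+1%:R^-1 * \sum_(w <- shuffles v [:: ly]) phi (nseq j ly ++ lx :: w)).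
Proof.
move=> vy; apply/eqP; rewrite -subr_eq0 opprK.
rewrite -(mulrI_eq0 _ (@mulfI R j.+1%:R _)) ?pnatr_eq0 // mulrDr mulVKf ?pnatr_eq0 //.
rewrite mulr_natl -sum_shuffles_y -(phi_shuffle Zsh_reg) ?(phi_y Zsh_reg) ?mulr0 //.
by rewrite last_cat.
Qed.

Lemma phi_ones j : phi (nseq j ly) = (j == 0%N)%:R.
Proof.
case: j => [|j]; first exact: phi_nil.
apply/eqP; rewrite -(mulrI_eq0 _ (@mulfI R j.+1%:R _)) ?pnatr_eq0 //.
rewrite mulr_natl -sum_shuffles_ones -(phi_shuffle Zsh_reg) ?(phi_y Zsh_reg) ?mulr0 //.
by elim: j.
Qed.

Lemma last_shuffles_y v w : w \in shuffles v [:: ly] -> last lx v = ly -> last lx w = ly.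
Proof.
move=> wP vy; have vn : v != [::] by case: (v) vy.
have wn : w != [::] by rewrite -size_eq0 (size_shuffles wP) addn1.
by rewrite last_lx // in vy; rewrite last_lx // (last_shuffles wP).
Qed.

Lemma phi_span v : last ly v = ly -> mzv_span (phi v).
Proof.
case/rwordP => l /index_split[j [r [-> rP r1]]] ->.
rewrite rword_cat rword_ones; case: r rP r1 => [|a t] rP a1.
  by rewrite cats0 phi_ones; case: j => [|j]; [exact: mzv_span1|exact: mzv_span0].
have [w -> wy] := rword_head2 t a1.
elim: j w wy => [|j IHj] w wy; first exact: phi_x_span.
rewrite phi_y_cat //; apply: mzv_spanN.
rewrite (_ : j.+1%:R^-1 = ratr (j.+1%:R^-1 : rat)); last by rewrite fmorphV rmorph_nat.
apply/mzv_spanZ/mzv_span_sum => u uP; apply: IHj; exact: last_shuffles_y uP wy.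
Qed.

Lemma star_value_span k : mzv_span (star_value phi k).
Proof.
case: k => [|a t] /=; first exact: mzv_span1.
elim: t [:: a] => [|b t IHt] l /=; first exact: phi_span (last_rword l).
apply: mzv_spanD; last exact: mzv_spanN.
by apply: mzv_spanM => //; exact: phi_span (last_rword l).
Qed.

End Span.

(** * Multiple polylogarithms *)

Section Coefficients.
Variable R : numFieldType.
Local Notation hsum := (@hsum R).

(* The coefficients of the multiple polylogarithm of a reversed word. *)
Fixpoint polylog (w : seq letter) (n : nat) : R :=
  match w with
  | [::] => (n == 0%N)%:R
  | true :: w' => n%:R^-1 * \sum_(m < n) polylog w' m
  | false :: w' => n%:R^-1 * polylog w' n
  end.

Lemma polylog_ge0 w n : 0 <= polylog w n.
Proof.
elim: w n => [|[] w IHw] n /=; first exact: ler0n.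
  by rewrite mulr_ge0 ?invr_ge0 ?ler0n // sumr_ge0.
by rewrite mulr_ge0 ?invr_ge0 ?ler0n.
Qed.

Lemma polylog0 w : w != [::] -> polylog w 0 = 0.
Proof. by case: w => [|[] w] //= _; rewrite ?big_ord0 ?mulr0 // invr0 mul0r. Qed.

Lemma polylog_rword a t n : (0 < a)%N -> is_index t ->
  polylog (rword (a :: t)) n.+1 = n.+1%:R ^- a * hsum t n.
Proof.
have step b u : polylog (rword (b.+1 :: u)) n.+1 =
    n.+1%:R ^- b.+1 * \sum_(m < n.+1) polylog (rword u) m.
  elim: b => [|b IHb]; first by rewrite /= expr1.
  by rewrite [LHS]/= -/(rword (b.+1 :: u)) [polylog _ _]IHb [in RHS]exprS invfM mulrA.
case: a => // a _ tP; rewrite step; congr (_ * _).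
elim: t n tP {step} => [|b t IHt] n.
  by rewrite big_ord_recl big1 ?addr0.
case/andP=> b0 tP; rewrite big_ord_recl polylog0 ?add0r; last first.
  by rewrite -size_eq0 rword_cons size_cat size_rcons.
rewrite -[RHS]/(\sum_(i < n) i.+1%:R ^- b * hsum t i).
apply: eq_bigr => i _; rewrite lift0 -IHt //.
elim: b b0 => // -[|b] IHb _; first by rewrite expr1.
by rewrite [LHS]/= -/(rword (b.+1 :: t)) [polylog _ _]IHb // [in RHS]exprS invfM mulrA.
Qed.

(** The weights are the coefficients of z/(1-z). *)
Lemma cauchy_psum (p : nat -> R) n :
  cauchy_prod (fun i : nat => (0 < i)%N%:R) p n = \sum_(m < n) p m.
Proof.
rewrite cauchyC /cauchy_prod big_ord_recr /= subnn mulr0 addr0.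
by apply: eq_bigr => i _; rewrite subn_gt0 ltn_ord mulr1.
Qed.

Lemma mul_polylog_y w i : i%:R * polylog (ly :: w) i = \sum_(m < i) polylog w m.
Proof.
case: i => [|i]; first by rewrite mul0r big_ord0.
by rewrite /= mulVKf // pnatr_eq0.
Qed.

(** The shuffle product of iterated integrals with one factor -log(1-z). Multiplying the n-th
    coefficient by n is the operator z d/dz, and the Leibniz rule removes the first letter of one
    factor or the other, as in the recursion for shuffles. *)
Lemma polylog_shuffle_y v n : last ly v = ly ->
  cauchy_prod (polylog v) (polylog [:: ly]) n = \sum_(u <- shuffles v [:: ly]) polylog u n.
Proof.
elim: v n => [|a v IHv] n vy.
  rewrite big_seq1 /cauchy_prod big_ord_recl /= mul1r subn0 [X in _ + X]big1 ?addr0 // => i _.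
  by rewrite mul0r.
have vy' : last ly v = ly by case: (v) vy.
case: n => [|n].
  rewrite /cauchy_prod big_ord1 polylog0 // mul0r big_seq big1 // => u uP.
  by rewrite polylog0 // -size_eq0 (size_shuffles uP) addn1.
apply: (@mulfI R n.+1%:R); first by rewrite pnatr_eq0.
rewrite shuffles_cons big_cat !big_map shuffles_nilr big_seq1 [RHS]mulrDr mul_polylog_y.
transitivity (cauchy_prod (fun i => i%:R * polylog (a :: v) i) (polylog [:: ly]) n.+1 +
    \sum_(m < n.+1) polylog (a :: v) m).
  rewrite [X in _ + X](_ : _ = cauchy_prod (polylog (a :: v))
      (fun i => i%:R * polylog [:: ly] i) n.+1); last first.
    rewrite -cauchy_psum cauchyC; apply: eq_cauchy => // i.
    rewrite mul_polylog_y; case: i => [|i]; first by rewrite big_ord0.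
    by rewrite big_ord_recl /= big1 ?addr0.
  rewrite /cauchy_prod mulr_sumr -big_split; apply: eq_bigr => i _ /=.
  have -> : n.+1%:R = i%:R + (n.+1 - i)%:R :> R.
    by rewrite -natrD subnKC // -ltnS ltn_ord.
  by rewrite mulrDl mulrA [in X in _ + X]mulrCA.
congr (_ + _); case: a vy => vy.
  rewrite (@eq_cauchy _ _ (cauchy_prod (fun i : nat => (0 < i)%N%:R) (polylog v)) _ (polylog [:: ly])) //; last first.
    by move=> i; rewrite cauchy_psum mul_polylog_y.
  rewrite cauchyA cauchy_psum big_distrr /=.
  rewrite (eq_bigr (fun u => \sum_(m < n.+1) polylog u m)) => [|u _]; last exact: mul_polylog_y.
  by rewrite exchange_big /=; apply: eq_bigr => m _; rewrite IHv.
have v0 : v != [::] by case: (v) vy.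
rewrite (@eq_cauchy _ _ (polylog v) _ (polylog [:: ly])) //; last first.
  by case=> [|i]; rewrite ?mul0r ?polylog0 //= mulVKf // pnatr_eq0.
by rewrite IHv // mulr_sumr; apply: eq_bigr => u _; rewrite /= mulVKf // pnatr_eq0.
Qed.

(** [polylog (nseq j ly)] lists the coefficients of (-log(1-z))^j / j!. *)
Lemma polylog_ones j n :
  cauchy_prod (polylog [:: ly]) (polylog (nseq j ly)) n = j.+1%:R * polylog (nseq j.+1 ly) n.
Proof.
rewrite cauchyC polylog_shuffle_y; last by elim: j.
by rewrite (sum_shuffles_ones (polylog^~ n)) mulr_natl.
Qed.

Lemma polylog_onesS j n : polylog (nseq j.+1 ly) n.+1 = n.+1%:R^-1 * hsum (nseq j 1%N) n.
Proof.
rewrite -rword_ones polylog_rword // ?expr1 //.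
by apply/allP => a /nseqP[->].
Qed.

(** A truncation of the integral of t^(n-1) (-log(1-t))^j / j! over [0, 1], obtained by expanding
    the power of the logarithm and integrating termwise. *)
Definition connector j M n : R := \sum_(m < M) polylog (nseq j ly) m * (m + n)%:R^-1.

Lemma connector0 M n : connector 0 M.+1 n = n%:R^-1.
Proof. by rewrite /connector big_ord_recl /= mul1r big1 ?addr0 // => i _; rewrite mul0r. Qed.

(* Summation by parts against
   (n+1)/(m+n+1) - n/(m+n) = m/((m+n)(m+n+1)). *)
Lemma connector_step j M n :
  n.+1%:R * connector j.+1 M.+1 n.+1 = n%:R * connector j.+1 M.+1 n +
    connector j M.+1 n.+1 - hsum (nseq j 1%N) M * (M.+1 + n)%:R^-1.
Proof.
elim: M => [|M IHM].
  have c1 i k : connector i 1 k = (i == 0%N)%:R * k%:R^-1.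
    by rewrite /connector big_ord1 add0n; case: i => [|i] //; rewrite polylog0.
  rewrite !c1 hsum0 add1n; case: j => [|j] /=; rewrite ?mul1r ?mul0r ?mulr0 ?subrr ?addrK //.
have recr i k : connector i M.+2 k =
    connector i M.+1 k + polylog (nseq i ly) M.+1 * (M.+1 + k)%:R^-1.
  by rewrite /connector big_ord_recr.
rewrite !recr !mulrDr IHM polylog_onesS.
have -> : hsum (nseq j 1%N) M.+1 = hsum (nseq j 1%N) M + polylog (nseq j ly) M.+1.
  case: j {IHM} => [|j]; first by rewrite /= addr0.
  by rewrite polylog_onesS [nseq j.+1 1%N]/= hsumS expr1.
move: (hsum _ _) (polylog _ _) (connector _ _ _) (connector _ _ _) => e p c c'.
have nz1 : M%:R + 1 != 0 :> R by rewrite natr1 pnatr_eq0.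
have nz2 : M%:R + 1 + n%:R != 0 :> R by rewrite natr1 -natrD pnatr_eq0.
have nz4 : M%:R + 1 + 1 + n%:R != 0 :> R by rewrite !natr1 -natrD pnatr_eq0.
by rewrite !natrD -!natr1; field; rewrite nz1 nz2 nz4.
Qed.

End Coefficients.

(** * Limits *)

Section Limits.
Variable R : realType.
Local Notation hsum := (@hsum R).
Local Notation hone := (@hone R).
Local Notation polylog := (@polylog R).
Local Notation connector := (@connector R).

Lemma cvg_sum_seq (I : eqType) (s : seq I) (u : I -> nat -> R) (l : I -> R) :
  (forall i, i \in s -> u i @ \oo --> l i) ->
  (fun n => \sum_(i <- s) u i n) @ \oo --> \sum_(i <- s) l i.
Proof.
elim: s => [|i s IHs] sl.
  by rewrite big_nil; under eq_fun do rewrite big_nil; exact: cvg_cst.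
rewrite big_cons; under eq_fun do rewrite big_cons.
apply: cvgD; first by apply: sl; rewrite mem_head.
by apply: IHs => j js; apply: sl; rewrite inE js orbT.
Qed.

Lemma cvg_sum_ord k (u : 'I_k -> nat -> R) (l : 'I_k -> R) :
  (forall i, u i @ \oo --> l i) ->
  (fun n => \sum_(i < k) u i n) @ \oo --> \sum_(i < k) l i.
Proof. by move=> ul; apply: cvg_sum_seq => i _; exact: ul. Qed.

Lemma cvg_shift (u : nat -> R) (l : R) : (fun n => u n.+1) @ \oo --> l -> u @ \oo --> l.
Proof. by rewrite -(cvg_shiftS u). Qed.

Lemma cvg_eqfun (u v : nat -> R) (l : R) : u =1 v -> u @ \oo --> l -> v @ \oo --> l.
Proof. by move=> /funext ->. Qed.

Lemma cvg_mull (k : R) (u : nat -> R) (l : R) :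
  u @ \oo --> l -> (fun n => k * u n) @ \oo --> k * l.
Proof. by move=> ul; apply: cvgM => //; exact: cvg_cst. Qed.

Lemma cvg_divl (k : R) (u : nat -> R) (l : R) : k != 0 ->
  (fun n => k * u n) @ \oo --> l -> u @ \oo --> k^-1 * l.
Proof.
move=> k0 kul; rewrite (_ : u = fun n => k^-1 * (k * u n)); first exact: cvg_mull.
by apply/funext => n; rewrite mulKf.
Qed.

Lemma cvg_squeeze (u v w : nat -> R) (l : R) : (forall n, u n <= v n <= w n) ->
  u @ \oo --> l -> w @ \oo --> l -> v @ \oo --> l.
Proof. by move=> uvw; apply: squeeze_cvgr; exact: nearW. Qed.

Lemma cvg_mono_le (u : nat -> R) (l : R) : (forall n, u n <= u n.+1) ->
  u @ \oo --> l -> forall n, u n <= l.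
Proof.
move=> mono ul n; apply: (cvgr_to_ge ul); exists n => // m /= nm.
by rewrite -(subnK nm); elim: (m - n)%N => // d IHd; apply: le_trans IHd (mono _).
Qed.

(* Cesaro: the averages of a null sequence tend to 0. *)
Lemma hsum_ones_div j : (fun M => hsum (nseq j 1%N) M / M.+1%:R) @ \oo --> (0 : R).
Proof.
elim: j => [|j IHj].
  under eq_fun do rewrite /= mul1r; exact: cvg_harmonic.
have := cesaro IHj.
apply: (@cvg_squeeze (fun=> 0)); last exact: cvg_cst.
move=> M; apply/andP; split; first by rewrite divr_ge0 ?hsum_ge0 ?ler0n.
rewrite /arithmetic_mean /= mulrC ler_pM2l ?invr_gt0 ?ltr0n // seriesEord /=.
rewrite big_ord_recr /= -[leLHS]addr0 lerD ?divr_ge0 ?hsum_ge0 ?ler0n //.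
by apply: ler_sum => i _; rewrite expr1 mulrC.
Qed.

(** In the limit [connector_step] becomes the recursion [honeS], its boundary term vanishing by
    [hsum_ones_div]. The premise excludes j = n = 0, where the left side is 0 and [hone 0 0] is
    1. *)
Lemma cvg_mul_connector j n : (j == 0)%N ==> (0 < n)%N ->
  (fun M => n%:R * connector j M.+1 n) @ \oo --> hone j n.
Proof.
elim: j n => [|j IHj] n /= n0.
  under eq_fun do rewrite connector0 mulfV ?pnatr_eq0 -?lt0n //.
  exact: cvg_cst.
elim: n {n0} => [|n IHn].
  under eq_fun do rewrite mul0r; rewrite /hone hstar0; exact: cvg_cst.
under eq_fun do rewrite connector_step.
rewrite honeS -[hone _ _ + _]subr0; apply: cvgB; first apply: cvgD => //.
  have := IHj n.+1; rewrite implybT => /(_ isT); apply: cvg_divl.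
  by rewrite pnatr_eq0.
apply: (cvg_squeeze _ _ (hsum_ones_div j)); last exact: cvg_cst.
move=> M; rewrite divr_ge0 ?hsum_ge0 ?ler0n //= ler_wpM2l ?hsum_ge0 //.
by rewrite lef_pV2 ?posrE ?ltr0n // ler_nat leq_addr.
Qed.

Lemma connector_le j M M' n : (M <= M')%N -> connector j M n <= connector j M' n.
Proof.
move=> MM; rewrite -(subnK MM) addnC; elim: (M' - M)%N => [|d IHd]; first by rewrite addn0.
rewrite addnS /connector big_ord_recr /=; apply: le_trans IHd _.
by rewrite lerDl mulr_ge0 ?polylog_ge0 // invr_ge0 ler0n.
Qed.

Lemma cvg_connector j n : (fun M => connector j M n.+1) @ \oo --> n.+1%:R^-1 * hone j n.+1.
Proof.
apply: cvg_shift; have := @cvg_mul_connector j n.+1; rewrite implybT => /(_ isT).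
by apply: cvg_divl; rewrite pnatr_eq0.
Qed.

(** The Cauchy product is regrouped by the index n of [polylog v]: as N = m + n < M, the other index
    m stays below M - n. *)
Lemma sum_connector v j M :
  \sum_(N < M) N%:R^-1 * cauchy_prod (polylog v) (polylog (nseq j ly)) N =
  \sum_(n < M) polylog v n * connector j (M - n) n.
Proof.
elim: M => [|M IHM]; first by rewrite !big_ord0.
rewrite big_ord_recr IHM /cauchy_prod /= mulr_sumr.
rewrite [X in X + _](_ : _ = \sum_(n < M.+1) polylog v n * connector j (M - n) n); last first.
  by rewrite big_ord_recr subnn /= /connector [X in _ = _ + _ * X]big_ord0 mulr0 addr0.
rewrite -big_split; apply: eq_bigr => n _ /=.
have nM : (n <= M)%N by rewrite -ltnS.
rewrite subSn // /connector [in RHS]big_ord_recr /= subnK // [RHS]mulrDr; congr (_ + _).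
by rewrite mulrC -mulrA.
Qed.

(** All terms are nonnegative. The sum over n < M with limiting connectors dominates the truncated
    sum [T M]; it is also at most L, because for each K its version with connectors cut at K is at
    most [T (M + K)]. *)
Lemma cvg_connected v j (L : R) : v != [::] ->
  (fun M => \sum_(N < M) N%:R^-1 * cauchy_prod (polylog v) (polylog (nseq j ly)) N)
    @ \oo --> L ->
  (fun M => \sum_(n < M) polylog v n * (n%:R^-1 * hone j n)) @ \oo --> L.
Proof.
move=> v0; under eq_fun do rewrite sum_connector.
set T := fun M : nat => _; move=> TL.
have le_term n M : polylog v n * connector j M n <= polylog v n * (n%:R^-1 * hone j n).
  case: n => [|n]; first by rewrite polylog0 // !mul0r.
  rewrite ler_wpM2l ?polylog_ge0 //.
  have mono K : connector j K n.+1 <= connector j K.+1 n.+1 by exact: connector_le.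
  exact: (cvg_mono_le mono (@cvg_connector j n)).
have term0 n M : 0 <= polylog v n * connector j M n.
  rewrite mulr_ge0 ?polylog_ge0 // -[leLHS](_ : connector j 0 n = 0) ?connector_le //.
  by rewrite /connector big_ord0.
have Tmono M : T M <= T M.+1.
  rewrite /T big_ord_recr -[leLHS]addr0 lerD //; apply: ler_sum => n _.
  by rewrite ler_wpM2l ?polylog_ge0 // connector_le // leq_sub2r.
have TleL := cvg_mono_le Tmono TL.
apply: (cvg_squeeze _ TL (cvg_cst L)) => M; apply/andP; split; first exact: ler_sum.
have VM : (fun K => \sum_(n < M) polylog v n * connector j K n) @ \oo -->
    \sum_(n < M) polylog v n * (n%:R^-1 * hone j n).
  apply: cvg_sum_ord => -[[|n] nM] /=.
    by rewrite polylog0 // mul0r; under eq_fun do rewrite mul0r; exact: cvg_cst.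
  by apply: cvg_mull; exact: cvg_connector.
apply: (cvgr_to_le VM); apply: nearW => K; apply: le_trans (TleL (M + K)%N).
rewrite /T big_split_ord /= -[leLHS]addr0 lerD ?sumr_ge0 //.
by apply: ler_sum => n _; rewrite ler_wpM2l ?polylog_ge0 // connector_le //; case: n => /=; lia.
Qed.

End Limits.

(** * Multiple zeta values as limits of truncated sums *)

Fixpoint increasing_seqs (r M : nat) : seq (seq nat) :=
  if r is r'.+1 then [seq rcons s n.+1 | n <- iota 0 M, s <- increasing_seqs r' n]
  else [:: [::]].

Lemma mem_increasing_seqs r M s : (s \in increasing_seqs r M) =
  [&& size s == r, path ltn 0%N s & last 0%N s <= M]%N.
Proof.
elim: r M s => [|r IHr] M s; first by rewrite inE; case: s.
apply/allpairsPdep/and3P => [[n [t [nM tP ->]]]|].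
  move: tP nM; rewrite IHr mem_iota add0n => /and3P[/eqP szt pt lt] /= nM.
  by rewrite size_rcons szt rcons_path pt last_rcons.
case/lastP: s => [[]|s n []] //; rewrite size_rcons eqSS rcons_path last_rcons => szs.
case/andP=> ps; case: n => [|n] // ln nM; exists n, s; split=> //.
  by rewrite mem_iota.
by rewrite IHr szs ps.
Qed.

Lemma uniq_increasing_seqs r M : uniq (increasing_seqs r M).
Proof.
elim: r M => [|r IHr] M //; apply: allpairs_uniq_dep; first exact: iota_uniq.
  by move=> n _; exact: IHr.
by move=> [n s] [m t] _ _ /rcons_inj[-> ->].
Qed.

Section ZetaLimit.
Variable R : realType.
Local Notation hsum := (@hsum R).

Lemma sum_increasing_seqs k M :
  \sum_(s <- increasing_seqs (size k) M) \prod_(i < size k) (nth 0%N s i)%:R ^- nth 0%N k i =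
  hsum (rev k) M.
Proof.
elim/last_ind: k M => [|k a IHk] M; first by rewrite big_seq1 big_ord0.
rewrite size_rcons big_allpairs_dep rev_rcons /= -(big_mkord xpredT (fun n => n.+1%:R ^- a * hsum (rev k) n)).
rewrite /index_iota subn0; apply: eq_bigr => n _.
rewrite -IHk mulr_sumr big_seq [RHS]big_seq; apply: eq_bigr => s.
rewrite mem_increasing_seqs => /and3P[/eqP szs _ _].
rewrite big_ord_recr /= !nth_rcons szs ltnn eqxx mulrC; congr (_ * _).
by apply: eq_bigr => i _; rewrite !nth_rcons szs ltn_ord.
Qed.

Lemma hsum_mono l N : hsum l N <= hsum l N.+1.
Proof.
case: l => [|a t]; rewrite ?hsumS //.
by rewrite lerDl mulr_ge0 ?hsum_ge0 // invr_ge0 exprn_ge0.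
Qed.

(** Truncations are finite and exhaust the index set: a finite set of tuples lies in the truncation
    at its largest entry. As the terms are nonnegative, the supremum over finite sets is the
    limit. *)
Lemma zeta_cvg k (L : R) : (fun N => hsum (rev k) N) @ \oo --> L -> zeta R k = L.
Proof.
move=> kL; rewrite /zeta; set S := [set n | _]; set a := (fun n => _%:E).
suff -> : \esum_(n in S) a n = L%:E by [].
pose ts M : seq ((size k).-tuple nat) := pmap insub (increasing_seqs (size k) M).
have mts M t : (t \in ts M) = (tval t \in increasing_seqs (size k) M).
  by rewrite mem_pmap_sub.
have sum_ts M : (\sum_(n \in [set` ts M]) a n)%E = (hsum (rev k) M)%:E.
  rewrite -fsbig_seq; last exact/pmap_sub_uniq/uniq_increasing_seqs.
  rewrite /a sumEFin; congr EFin; rewrite -sum_increasing_seqs big_pmap.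
  rewrite big_seq [RHS]big_seq; apply: eq_bigr => s.
  rewrite mem_increasing_seqs => /and3P[szs _ _]; rewrite insubT /=.
  by apply: eq_bigr => i _; rewrite (tnth_nth 0%N).
have a0 t : (0 <= a t)%E.
  by rewrite lee_fin prodr_ge0 // => i _; rewrite invr_ge0 exprn_ge0.
apply/eqP; rewrite eq_le; apply/andP; split; last first.
  have Lub M : ((hsum (rev k) M)%:E <= \esum_(n in S) a n)%E.
    rewrite -sum_ts; apply: ereal_sup_ubound; exists [set` ts M] => //; split; [exact: finite_seq | move=> t /=].
    by rewrite mts mem_increasing_seqs => /and3P[].
  move: Lub; case: (\esum_(n in S) a n)%E => [x Lub|_|/(_ 0%N)] //; last by rewrite leey.
  rewrite lee_fin; apply: (cvgr_to_le kL); apply: nearW => M.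
  by have := Lub M; rewrite lee_fin.
apply: ge_ereal_sup => _ [A [finA AS] <-].
have /finite_seqP[s As] := finA.
pose M := (\max_(t <- s) last 0%N (tval t))%N.
apply: (@le_trans _ _ (hsum (rev k) M)%:E); last first.
  by rewrite lee_fin; apply: (cvg_mono_le _ kL) => N; exact: hsum_mono.
rewrite -sum_ts; apply: lee_fsum_nneg_subset => //; first exact: finite_seq.
move=> t.
rewrite !inE /= mts mem_increasing_seqs size_tuple eqxx => At.
rewrite (AS _ At) /=; move: At; rewrite As /= => ts'.
by rewrite /M (big_rem t ts') /= leq_maxl.
Qed.

(** Each entry costs a factor 2. As 1/n^2 <= 2 (1/n - 1/(n+1)), summation by parts bounds the sum
    for [b :: t] by twice the sum of n^-b (n+1)^-1 against the sums of [t], and b >= 1 restores the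
    exponent 2. *)
Lemma hsum_bound t N : is_index t ->
  \sum_(n < N) n.+1%:R ^- 2 * hsum t n <= 2 ^+ (size t).+1.
Proof.
(* The nonnegative boundary term is added so that the summation by parts becomes exact. *)
have step u M : \sum_(n < M) n.+1%:R ^- 2 * hsum u n <=
    \sum_(n < M) 2 * (n.+1%:R^-1 - n.+2%:R^-1) * hsum u n + 2 * hsum u M * M.+1%:R^-1.
  rewrite -[leLHS]addr0 lerD //; last by rewrite !mulr_ge0 ?hsum_ge0 // invr_ge0.
  apply: ler_sum => n _; rewrite ler_wpM2r ?hsum_ge0 //.
  have n1 : (0 : R) < n.+1%:R by rewrite ltr0n.
  have n2 : (0 : R) < n.+2%:R by rewrite ltr0n.
  have -> : 2 * (n.+1%:R^-1 - n.+2%:R^-1) = 2 * n.+1%:R * n.+2%:R^-1 * n.+1%:R ^- 2 :> R.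
    by rewrite -[n.+2]addn1 natrD; field; rewrite addrC natr1 pnatr_eq0 /= natr1 pnatr_eq0.
  rewrite ler_peMl ?invr_ge0 ?exprn_ge0 ?ler0n // ler_pdivlMr // mul1r.
  by rewrite -natrM ler_nat; lia.
elim: t N => [|b t IHt] N tP; apply: le_trans (step _ _) _.
  under eq_bigr do rewrite mulr1; rewrite mulr1 expr1 -mulr_sumr -mulrDr.
  suff -> : \sum_(n < N) (n.+1%:R^-1 - n.+2%:R^-1) + N.+1%:R^-1 = 1 :> R by rewrite mulr1.
  elim: N => [|N IHN]; first by rewrite big_ord0 add0r invr1.
  by rewrite big_ord_recr /= -addrA addrNK.
apply: le_trans (_ : 2 * \sum_(n < N) n.+1%:R ^- 2 * hsum t n <= _); last first.
  by rewrite exprS ler_wpM2l // IHt //; case/andP: tP.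
have b0 : (0 < b)%N by case/andP: tP.
elim: N => [|N IHN]; first by rewrite !big_ord0 /= big_ord0 !mulr0 mul0r addr0.
rewrite !big_ord_recr hsumS; move: (hsum (b :: t)) IHN => h.
set S := \sum_(_ < N) _; set S' := \sum_(_ < N) _ => IHN; rewrite /= [leRHS]mulrDr.
have -> : S + 2 * (N.+1%:R^-1 - N.+2%:R^-1) * h N + 2 * (h N + N.+1%:R ^- b * hsum t N) * N.+2%:R^-1 =
    S + 2 * h N * N.+1%:R^-1 + 2 * (N.+1%:R ^- b * N.+2%:R^-1 * hsum t N) by ring.
rewrite lerD // ler_wpM2l // ler_wpM2r ?hsum_ge0 // expr2 invfM.
apply: ler_pM; rewrite ?invr_ge0 ?exprn_ge0 ?ler0n //.
  by rewrite lef_pV2 ?posrE ?exprn_gt0 ?ltr0n // -[leLHS]expr1 ler_weXn2l ?ler1n.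
by rewrite lef_pV2 ?posrE ?ltr0n // ler_nat.
Qed.


Lemma cvg_hsum a t : is_index t -> (1 < a)%N ->
  (fun N => hsum (a :: t) N) @ \oo --> zeta R (rev (a :: t)).
Proof.
move=> tP a1.
have cv : cvgn (fun N => hsum (a :: t) N).
  apply: nondecreasing_is_cvgn.
    by apply/nondecreasing_seqP => N; exact: hsum_mono.
  exists (2 ^+ (size t).+1) => _ [N _ <-].
  apply: le_trans (hsum_bound N tP); apply: ler_sum => n _.
  rewrite ler_wpM2r ?hsum_ge0 // lef_pV2 ?posrE ?exprn_gt0 ?ltr0n //.
  by apply: ler_weXn2l; rewrite ?ler1n.
by rewrite (zeta_cvg (L := lim ((fun N => hsum (a :: t) N) @ \oo))) ?revK.
Qed.

End ZetaLimit.

(** * Regularized values as limits *)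

Section RegularizedLimit.
Variables (R : realType) (Zsh : hoffman -> {poly R}).
Hypothesis Zsh_reg : is_shuffle_regularization Zsh.
Local Notation phi := (phi Zsh).
Local Notation hsum := (@hsum R).
Local Notation hreg := (@hreg R).
Local Notation polylog := (@polylog R).

Lemma cauchy_delta (p : nat -> R) n : cauchy_prod p (polylog [::]) n = p n.
Proof.
by rewrite cauchyC /cauchy_prod big_ord_recl /= mul1r subn0 big1 ?addr0 // => i _; rewrite mul0r.
Qed.

(** The sums approximate the integral of Li_v(z) (-log(1-z))^j / j! against dz/z. [phi_y_cat] moves
    one y inwards, and [polylog_shuffle_y] turns the resulting shuffles into a factor -log(1-z),
    which joins the power. *)
Lemma cvg_phi j v : last lx v = ly ->
  (fun M => \sum_(N < M) N%:R^-1 * cauchy_prod (polylog v) (polylog (nseq j ly)) N)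
    @ \oo --> (-1) ^+ j * phi (nseq j ly ++ lx :: v).
Proof.
elim: j v => [|j IHj] v vy.
  rewrite expr0 mul1r; under eq_fun do under eq_bigr do rewrite cauchy_delta.
  have [[|a t] lP vE] // := @rwordP (lx :: v) vy.
  have a1 : (1 < a)%N by case: a lP vE => [|[|a]].
  have /andP[_ tP] := lP.
  rewrite -[nseq 0 ly ++ _]/(lx :: v) vE (phi_admissible Zsh_reg) //.
  apply: cvg_shift; have := @cvg_hsum R a t tP a1; apply: cvg_eqfun => N.
  apply/esym; rewrite big_ord_recl invr0 mul0r add0r.
  by apply: eq_bigr => i _; rewrite lift0 -(polylog_rword _ _ (ltnW a1)) // -vE.
have IHw : (fun M => - (j.+1%:R^-1 * \sum_(w <- shuffles v [:: ly])
    \sum_(N < M) N%:R^-1 * cauchy_prod (polylog w) (polylog (nseq j ly)) N)) @ \oo -->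
    (-1) ^+ j * phi (nseq j.+1 ly ++ lx :: v).
  rewrite (phi_y_cat Zsh_reg) // mulrN mulrCA mulr_sumr.
  apply: cvgN; apply: cvg_mull; apply: cvg_sum_seq => w wP.
  by apply: IHj; exact: last_shuffles_y wP vy.
move/cvgN: IHw; rewrite exprS mulN1r -mulNr; apply: cvg_eqfun => M.
 rewrite opprK exchange_big mulr_sumr; apply: eq_bigr => N _ /=.
rewrite -mulr_sumr mulrCA; congr (_ * _).
have -> : \sum_(w <- shuffles v [:: ly]) cauchy_prod (polylog w) (polylog (nseq j ly)) N =
    cauchy_prod (cauchy_prod (polylog v) (polylog [:: ly])) (polylog (nseq j ly)) N.
  rewrite /cauchy_prod exchange_big /=; apply: eq_bigr => i _.
  by rewrite -mulr_suml -polylog_shuffle_y //; case: (v) vy.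
rewrite cauchyA (eq_cauchy (p' := polylog v) (q' := fun n => j.+1%:R * polylog (nseq j.+1 ly) n)) //.
  rewrite /cauchy_prod mulr_sumr; apply: eq_bigr => i _.
  by rewrite mulrCA mulKf // pnatr_eq0.
by move=> n; rewrite polylog_ones.
Qed.

Lemma cvg_hreg l : is_index l -> (fun N => hreg N l) @ \oo --> phi (rword l).
Proof.
case/index_split => j [r [-> rP]]; case: r rP => [|a t] rP a1.
  rewrite cats0 rword_ones (phi_ones Zsh_reg); under eq_fun do rewrite hreg_ones.
  exact: cvg_cst.
have [v vE vy] := rword_head2 t a1; have v0 : v != [::] by case: (v) vy.
have /andP[_ tP] := rP.
rewrite rword_cat rword_ones vE -[phi _](signrMK j).
under eq_fun do rewrite hreg_cat_ones //.
have := cvg_mull (k := (-1) ^+ j) (cvg_connected v0 (cvg_phi (j := j) vy)).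
rewrite -cvg_shiftS /=; apply: cvg_eqfun => N.
 rewrite big_ord_recl invr0 mul0r mulr0 add0r mulr_sumr.
apply: eq_bigr => i _; rewrite lift0 /hone_sgn.
have -> : i.+1%:R ^- a * ((-1) ^+ j * hone R j i.+1) * hsum t i =
  (-1) ^+ j * hone R j i.+1 * (i.+1%:R ^- a * hsum t i) by ring.
rewrite -(polylog_rword _ _ (ltnW a1)) // vE [polylog (lx :: v) _]/=; ring.
Qed.

End RegularizedLimit.

(** * Even zeta values *)

Section EvenZeta.
Variable R : realType.
Local Notation hsum := (@hsum R).
Local Notation hstar := (@hstar R).
Local Notation hsin := (@hsin R).

Definition psum i N : R := hsum [:: i.*2] N.

Lemma psumS i N : psum i N.+1 = psum i N + N.+1%:R ^- i.*2.
Proof. by rewrite /psum hsumS mulr1. Qed.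

(** Newton's identity for the variables m^-2, m <= N, with power sums [psum] and complete symmetric
    polynomials [hstar (nseq i 2) N]. A further variable x = (N+1)^-2 changes the latter by h'_(j+1)
    = h_(j+1) + x h'_j. *)
Lemma newton_hstar i N :
  \sum_(a < i) psum a.+1 N * hstar (nseq (i - a.+1) 2%N) N = i%:R * hstar (nseq i 2%N) N.
Proof.
elim: N i => [|N IHN] i.
  rewrite big1 => [|a _]; last by rewrite /psum hsum0 mul0r.
  by case: i => [|i]; rewrite ?mul0r // hstar0 mulr0.
elim: i => [|i IHi]; first by rewrite big_ord0 mul0r.
set x : R := N.+1%:R ^- 2; set h' := fun j => hstar (nseq j 2%N) N.+1.
set h := fun j => hstar (nseq j 2%N) N.
have hS j : h' j.+1 = h j.+1 + x * h' j by exact: hstarS.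
have xE a : N.+1%:R ^- a.+1.*2 = x ^+ a.+1 by rewrite /x -exprVn -exprVn -exprM mul2n.
transitivity (\sum_(a < i.+1) psum a.+1 N * h (i.+1 - a.+1)%N +
    x * (\sum_(a < i) psum a.+1 N.+1 * h' (i - a.+1)%N + h' i)); last first.
  rewrite (IHN i.+1) IHi -/(h i.+1) -/(h' i) -/(h' i.+1) hS -natr1; ring.
have -> : \sum_(a < i.+1) psum a.+1 N.+1 * h' (i.+1 - a.+1)%N =
    \sum_(a < i.+1) psum a.+1 N * h' (i.+1 - a.+1)%N +
    \sum_(a < i.+1) x ^+ a.+1 * h' (i.+1 - a.+1)%N.
  by rewrite -big_split; apply: eq_bigr => a _; rewrite /= psumS xE mulrDl.
have -> : \sum_(a < i.+1) x ^+ a.+1 * h' (i.+1 - a.+1)%N =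
    x * h' i + x * \sum_(a < i) x ^+ a.+1 * h' (i - a.+1)%N.
  rewrite big_ord_recl expr1 subSS subn0 mulr_sumr; congr (_ + _).
  by apply: eq_bigr => a _; rewrite lift0 subSS exprS mulrA.
have -> : \sum_(a < i.+1) psum a.+1 N * h' (i.+1 - a.+1)%N =
    \sum_(a < i.+1) psum a.+1 N * h (i.+1 - a.+1)%N +
    x * \sum_(a < i) psum a.+1 N * h' (i - a.+1)%N.
  rewrite !big_ord_recr !subnn [h' 0%N]/= [h 0%N]/= addrAC mulr_sumr -big_split.
  congr (_ + _); apply: eq_bigr => a _ /=.
  have -> : (i.+1 - a.+1 = (i - a.+1).+1)%N by rewrite subSn.
  by rewrite hS; ring.
have -> : \sum_(a < i) psum a.+1 N.+1 * h' (i - a.+1)%N =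
    \sum_(a < i) psum a.+1 N * h' (i - a.+1)%N + \sum_(a < i) x ^+ a.+1 * h' (i - a.+1)%N.
  by rewrite -big_split; apply: eq_bigr => a _; rewrite /= psumS xE mulrDl.
by ring.
Qed.

Lemma hsin_even N i : hsin N i.*2 = hstar (nseq i 2%N) N /\ hsin N i.*2.+1 = 0.
Proof.
elim: N i => [|N IHN] i.
  by rewrite hsin0 hstar0; case: i => [|i]; rewrite ?hsin0 //; case: (hsin_rec R 0 0) => ->.
elim: i => [|i [IHi IHi']]; first by case: (hsin_rec R N.+1 0) => -> ->.
have [_ _ E] := hsin_rec R N i.*2; have [_ _ O] := hsin_rec R N i.*2.+1.
rewrite doubleS E O IHi IHi' [nseq i.+1 _]/= hstarS -doubleS.
by have [-> ->] := IHN i.+1; rewrite mulr0 addr0.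
Qed.

Local Notation harm := (hsum [:: 1%N]).

Lemma harmS M : harm M.+1 = harm M + M.+1%:R^-1.
Proof. by rewrite hsumS expr1 mulr1. Qed.

(* Division by 0 yields 0, so the diagonal terms vanish. *)
Definition gap (n k : nat) : R := (k.+1%:R ^+ 2 - n.+1%:R ^+ 2)^-1.

(** With n and k standing for [n.+1] and [k.+1], the expansion 1/(k^2 - n^2) = (1/(k - n) - 1/(k +
    n)) / (2n) sums to differences of harmonic numbers. *)
Lemma sum_gap_below n d e : n = (d + e)%N ->
  \sum_(k < d) gap n k =
  (2 * n.+1%:R)^-1 * (harm e - harm n - (harm (n.+1 + d) - harm n.+1)).
Proof.
elim: d e => [|d IHd] e nde.
  by rewrite big_ord0 addn0 (_ : e = n) ?subrr ?subr0 ?mulr0 //; lia.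
have -> : \sum_(k < d.+1) gap n k = \sum_(k < d) gap n k + gap n d by rewrite big_ord_recr.
rewrite (IHd e.+1); last by lia.
rewrite addnS !harmS /gap; move: (harm _) (harm _) (harm _) => u v w.
have -> : n.+1%:R = d%:R + e%:R + 2 :> R by rewrite nde -!natrD; congr (_%:R); lia.
have -> : (n.+1 + d).+1%:R = 2 * d%:R + e%:R + 3 :> R by rewrite nde -natrM -!natrD; congr (_%:R); lia.
have e1 : e%:R + 1 != 0 :> R by rewrite natr1 pnatr_eq0.
have de2 : d%:R + e%:R + 2 != 0 :> R by rewrite -!natrD pnatr_eq0 addn2.
have de3 : 2 * d%:R + e%:R + 3 != 0 :> R by rewrite -natrM -!natrD pnatr_eq0 addn3.
have sq : (d%:R + 1) ^+ 2 - (d%:R + e%:R + 2) ^+ 2 != 0 :> R.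
  rewrite (_ : _ - _ = - ((e%:R + 1) * (2 * d%:R + e%:R + 3))); last by ring.
  by rewrite oppr_eq0 mulf_neq0.
by rewrite -!natr1; field; rewrite de2 de3 sq e1 natr1 pnatr_eq0.
Qed.

(** With n standing for [n.+1]: as d grows the harmonic difference tends to 0 and leaves 3/(4 n^2),
    the sum of 1/(k^2 - n^2) over k other than n. The constant arises at d = 0 as (1/n + 1/(2n)) /
    (2n). *)
Lemma sum_gap n d :
  \sum_(k < n.+1 + d) gap n k = 3 / 4 * n.+1%:R ^- 2 -
    (2 * n.+1%:R)^-1 * (harm (n.+1 + d + n.+1) - harm d).
Proof.
elim: d => [|d IHd].
  have -> : \sum_(k < n.+1 + 0) gap n k = \sum_(k < n) gap n k + gap n n.
    by rewrite addn0 big_ord_recr.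
  rewrite (@sum_gap_below n n 0) ?addn0 // /gap subrr invr0 addr0 hsum0 addnS -addSn !harmS.
  have -> : (n.+1 + n).+1%:R = 2 * n.+1%:R :> R by rewrite -natrM; congr (_%:R); lia.
  have : n.+1%:R != 0 :> R by rewrite pnatr_eq0.
  move: (harm _) (harm _) ((n.+1 + n)%:R^-1) (n.+1%:R) => u v c x x0.
  by field.
have -> : \sum_(k < n.+1 + d.+1) gap n k = \sum_(k < n.+1 + d) gap n k + gap n (n.+1 + d).
  by rewrite addnS big_ord_recr.
have -> : (n.+1 + d.+1 + n.+1 = (n.+1 + d + n.+1).+1)%N by lia.
rewrite IHd !(harmS d) (harmS (n.+1 + d + n.+1)) /gap; move: (harm _) (harm _) => u v.
have -> : (n.+1 + d).+1%:R = n%:R + d%:R + 2 :> R by rewrite -!natrD; congr (_%:R); lia.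
have -> : (n.+1 + d + n.+1).+1%:R = 2 * n%:R + d%:R + 3 :> R by rewrite -natrM -!natrD; congr (_%:R); lia.
have d1 : d%:R + 1 != 0 :> R by rewrite natr1 pnatr_eq0.
have n1 : n%:R + 1 != 0 :> R by rewrite natr1 pnatr_eq0.
have nd3 : 2 * n%:R + d%:R + 3 != 0 :> R by rewrite -natrM -!natrD pnatr_eq0 addn3.
have sq : (n%:R + d%:R + 2) ^+ 2 - (n%:R + 1) ^+ 2 != 0 :> R.
  rewrite (_ : _ - _ = (d%:R + 1) * (2 * n%:R + d%:R + 3)); last by ring.
  by rewrite mulf_neq0.
by rewrite -!natr1; field; rewrite nd3 d1 sq n1.
Qed.

Lemma harm_gap_le M K : harm (M + K) - harm M <= K%:R / M.+1%:R.
Proof.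
elim: K => [|K IHK]; first by rewrite addn0 subrr mul0r.
rewrite addnS harmS addrAC -[K.+1%:R]natr1 mulrDl lerD // mul1r.
by rewrite lef_pV2 ?posrE ?ltr0n // ler_nat ltnS leq_addr.
Qed.

Lemma harm_mono M K : harm M <= harm (M + K).
Proof. by elim: K => [|K IHK]; rewrite ?addn0 // addnS (le_trans IHK) ?hsum_mono. Qed.

(* Partial fractions: for x = n^-2 and y = k^-2 distinct, the sum over a of
   x^(a+1) y^(m+1-a) is (x^(m+1) - y^(m+1)) / (k^2 - n^2). *)
Lemma sum_psum m N :
  \sum_(a < m.+1) psum a.+1 N * psum (m.+1 - a) N =
  m.+1%:R * psum m.+2 N +
  2 * \sum_(n < N) n.+1%:R ^- m.+1.*2 * \sum_(k < N) gap n k.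
Proof.
pose x (n : nat) : R := n.+1%:R ^- 2.
have xE n a : n.+1%:R ^- a.*2 = x n ^+ a by rewrite /x -!exprVn -exprM mul2n.
have pE a : psum a N = \sum_(n < N) x n ^+ a.
  by apply: eq_bigr => n _; rewrite mulr1 xE.
have term n k : \sum_(a < m.+1) x n ^+ a.+1 * x k ^+ (m.+1 - a) =
    (n == k)%:R * (m.+1%:R * x n ^+ m.+2) + (x n ^+ m.+1 - x k ^+ m.+1) * gap n k.
  case: eqVneq => [->|nk].
    rewrite subrr mul0r addr0 mul1r mulr_natl -[X in _ *+ X](card_ord m.+1) -sumr_const.
    by apply: eq_bigr => a _; rewrite -exprD addSn subnKC ?(ltnW (ltn_ord a)).
  rewrite mul0r add0r.
  have -> : \sum_(a < m.+1) x n ^+ a.+1 * x k ^+ (m.+1 - a) =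
      x n * x k * \sum_(a < m.+1) x k ^+ (m - a) * x n ^+ a.
    rewrite mulr_sumr; apply: eq_bigr => a _; rewrite exprS subSn -1?ltnS ?ltn_ord // exprS.
    by ring.
  have X0 : n.+1%:R ^+ 2 != 0 :> R by rewrite expf_neq0 ?pnatr_eq0.
  have Y0 : k.+1%:R ^+ 2 != 0 :> R by rewrite expf_neq0 ?pnatr_eq0.
  have XY : n.+1%:R ^+ 2 - k.+1%:R ^+ 2 != 0 :> R.
    by rewrite subr_eq0 eqrXn2 ?ler0n // eqr_nat eqSS.
  have YX : k.+1%:R ^+ 2 - n.+1%:R ^+ 2 != 0 :> R by rewrite -opprB oppr_eq0.
  have xkn : x k - x n = (n.+1%:R ^+ 2 - k.+1%:R ^+ 2) / (n.+1%:R ^+ 2 * k.+1%:R ^+ 2).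
    rewrite /x; move: X0 Y0 {XY YX}; move: (n.+1%:R ^+ 2) (k.+1%:R ^+ 2) => X Y X0 Y0.
    by field; rewrite X0 Y0.
  have -> : \sum_(a < m.+1) x k ^+ (m - a) * x n ^+ a =
      (x k ^+ m.+1 - x n ^+ m.+1) / (x k - x n).
    rewrite [in RHS]subrXX mulrC mulKf // xkn mulf_neq0 // invr_eq0 mulf_neq0 //.
  rewrite xkn /gap {1 2}/x; move: (x k ^+ _) (x n ^+ _) => u v.
  move: X0 Y0 XY YX; move: (n.+1%:R ^+ 2) (k.+1%:R ^+ 2) => X Y X0 Y0 XY YX.
  by field; rewrite X0 Y0 XY YX.
transitivity (\sum_(n < N) \sum_(k < N) ((n == k :> nat)%:R * (m.+1%:R * x n ^+ m.+2) +
    (x n ^+ m.+1 - x k ^+ m.+1) * gap n k)).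
  under eq_bigr do rewrite !pE mulr_suml; rewrite exchange_big /=.
  apply: eq_bigr => n _; under eq_bigr do rewrite mulr_sumr.
  by rewrite exchange_big /=; apply: eq_bigr => k _; rewrite -term.
under eq_bigr do rewrite big_split /=.
rewrite big_split /=; congr (_ + _).
  rewrite pE mulr_sumr; apply: eq_bigr => n _.
  rewrite (bigD1 n) //= eqxx mul1r big1 ?addr0 // => k kn.
  by rewrite eq_sym (_ : (k == n :> nat) = false) ?mul0r //; exact: negbTE.
have swap : \sum_(n < N) \sum_(k < N) x k ^+ m.+1 * gap n k =
    - \sum_(n < N) x n ^+ m.+1 * \sum_(k < N) gap n k.
  rewrite exchange_big -sumrN; apply: eq_bigr => n _ /=; rewrite -mulr_sumr -mulrN.
  congr (_ * _); rewrite -sumrN; apply: eq_bigr => k _; rewrite /gap -invrN opprB //.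
under eq_bigr do (under eq_bigr do rewrite mulrBl; rewrite sumrB).
rewrite sumrB swap opprK mulr_natl mulr2n; congr (_ + _); apply: eq_bigr => n _.
  by rewrite -mulr_sumr xE.
by rewrite xE.
Qed.

(** The error in Euler's recursion for truncated sums, coming from the harmonic difference in
    [sum_gap]. *)
Definition gap_error m N : R := \sum_(n < N) n.+1%:R ^- m.+1.*2 *
  (n.+1%:R^-1 * (harm (N + n.+1) - harm (N - n.+1))).

(** With n standing for [n.+1], the harmonic difference has 2n terms, each at most 1/(N + 1 - n).
    The n-th summand is thus at most 2/(n (N + 1 - n)) = 2/(N + 1) (1/n + 1/(N + 1 - n)), and these
    add up to 4/(N + 1) times a harmonic number. *)
Lemma gap_error_cvg m : (fun N => gap_error m N) @ \oo --> (0 : R).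
Proof.
have := cvg_mull (k := 4) (@hsum_ones_div R 1); rewrite mulr0.
apply: (@cvg_squeeze _ (fun=> 0)); last exact: cvg_cst.
move=> N; apply/andP; split.
  apply: sumr_ge0 => n _; rewrite !mulr_ge0 ?invr_ge0 ?exprn_ge0 ?ler0n // subr_ge0.
  have -> : (N + n.+1 = N - n.+1 + (n.+1 + n.+1))%N by have := ltn_ord n; lia.
  exact: harm_mono.
have sym : \sum_(n < N) (N - n)%:R^-1 = harm N.
  rewrite (reindex_inj rev_ord_inj) /=; apply: eq_bigr => n _.
  by rewrite expr1 mulr1 subKn.
have -> : 4 * (harm N / N.+1%:R) =
    \sum_(n < N) 2 / N.+1%:R * (n.+1%:R^-1 + (N - n)%:R^-1).
  transitivity (2 / N.+1%:R * (harm N + harm N)).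
    by move: (harm N) (N.+1%:R^-1) => u v; ring.
  rewrite -mulr_sumr big_split sym; congr (_ * (_ + _)).
  by apply: eq_bigr => n _; rewrite expr1 mulr1.
apply: ler_sum => n _; have nN := ltn_ord n.
have n0 : n.+1%:R != 0 :> R by rewrite pnatr_eq0.
have Nn0 : (N - n)%:R != 0 :> R by rewrite pnatr_eq0 subn_eq0 -ltnNge.
have -> : 2 / N.+1%:R * (n.+1%:R^-1 + (N - n)%:R^-1) =
    n.+1%:R^-1 * (n.+1%:R^-1 * ((n.+1 + n.+1)%:R / (N - n.+1).+1%:R)) :> R.
  have -> : (N - n.+1).+1 = (N - n)%N by lia.
  have -> : N.+1%:R = n.+1%:R + (N - n)%:R :> R by rewrite -natrD; congr (_%:R); lia.
  have : n.+1%:R + (N - n)%:R != 0 :> R by rewrite -natrD pnatr_eq0.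
  rewrite natrD; move: n0 Nn0; move: (n.+1%:R) ((N - n)%:R) => u v u0 v0 uv.
  by field; rewrite u0 v0 uv.
have le1 : n.+1%:R ^- m.+1.*2 <= n.+1%:R^-1 :> R.
  rewrite lef_pV2 ?posrE ?exprn_gt0 ?ltr0n // -[leLHS]expr1.
  by apply: ler_weXn2l; rewrite ?ler1n.
have NE : (N + n.+1 = N - n.+1 + (n.+1 + n.+1))%N by lia.
rewrite NE ler_pM ?invr_ge0 ?exprn_ge0 ?ler0n ?le1 //.
  by rewrite mulr_ge0 ?invr_ge0 ?ler0n // subr_ge0 harm_mono.
by rewrite ler_wpM2l ?invr_ge0 ?ler0n // harm_gap_le.
Qed.

Lemma cvg_psum i : (fun N => psum i.+1 N) @ \oo --> zeta R [:: i.+1.*2].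
Proof. exact: (@cvg_hsum R i.+1.*2 [::]). Qed.

(** The constant is m + 1 from the diagonal of [sum_psum] plus twice the 3/4 of [sum_gap]. *)
Lemma euler_even_zeta m : (m%:R + 5 / 2) * zeta R [:: m.+2.*2] =
  \sum_(a < m.+1) zeta R [:: a.+1.*2] * zeta R [:: (m - a).+1.*2].
Proof.
pose u N := (m%:R + 5 / 2) * psum m.+2 N - gap_error m N.
have uE N : u N = \sum_(a < m.+1) psum a.+1 N * psum (m - a).+1 N.
  transitivity (\sum_(a < m.+1) psum a.+1 N * psum (m.+1 - a) N); last first.
    by apply: eq_bigr => a _; rewrite subSn // -ltnS.
  rewrite sum_psum /u /gap_error.
  suff -> : \sum_(n < N) n.+1%:R ^- m.+1.*2 * \sum_(k < N) gap n k =
      3 / 4 * psum m.+2 N - 2^-1 * gap_error m N.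
    by rewrite -/(gap_error m N) -natr1; move: (psum _ _) (gap_error _ _) => p e; field.
  rewrite /psum /= !mulr_sumr -sumrB; apply: eq_bigr => n _.
  have := sum_gap n (N - n.+1); rewrite subnKC ?ltn_ord // => ->.
  have -> : n.+1%:R ^+ m.+2.*2 = n.+1%:R ^+ m.+1.*2 * n.+1%:R ^+ 2 :> R by rewrite -exprD addn2.
  rewrite mulr1.
  move: (harm _ - harm _) => h.
  have : n.+1%:R != 0 :> R by rewrite pnatr_eq0.
  have : n.+1%:R ^+ m.+1.*2 != 0 :> R by rewrite expf_neq0 ?pnatr_eq0.
  set w : R := n.+1%:R; set v : R := w ^+ m.+1.*2 => v0 w0.
  by clearbody v; clearbody w; field; rewrite ?v0 ?w0.
have uL : u @ \oo --> (m%:R + 5 / 2) * zeta R [:: m.+2.*2].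
  rewrite -[X in _ --> X]subr0; apply: cvgB; last exact: gap_error_cvg.
  by apply: cvg_mull; exact: cvg_psum.
apply: (norm_cvg_unique uL); apply: cvg_eqfun (fun N => esym (uE N)) _.
apply: cvg_sum_ord => a; apply: cvgM; exact: cvg_psum.
Qed.

Variable Zsh : hoffman -> {poly R}.
Hypothesis Zsh_reg : is_shuffle_regularization Zsh.

Definition zeta2_multiple (x : R) : Prop := exists2 c, mzv_span c & x = zeta R [:: 2%N] * c.

Lemma mzv_span_even i : mzv_span (zeta R [:: i.+1.*2]).
Proof. exact: mzv_span_zeta. Qed.

Lemma zeta2_multipleM x y : zeta2_multiple x -> mzv_span y -> zeta2_multiple (x * y).
Proof.
by move=> [c cP ->] yP; exists (c * y); rewrite ?mulrA //; exact: mzv_spanM Zsh_reg _ _ _ _.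
Qed.

Lemma zeta2_multiple_sum (I : eqType) (s : seq I) (F : I -> R) :
  (forall i, i \in s -> zeta2_multiple (F i)) -> zeta2_multiple (\sum_(i <- s) F i).
Proof.
move=> sF; rewrite big_seq; elim/big_rec: _ => [|i x /sF[c cP ->] [e eP ->]].
  by exists 0; rewrite ?mulr0 //; exact: mzv_span0.
by exists (c + e); rewrite ?mulrDr //; exact: mzv_spanD.
Qed.

Lemma zeta2_multipleZ (q : rat) x : zeta2_multiple x -> zeta2_multiple (ratr q * x).
Proof. by move=> [c cP ->]; exists (ratr q * c); [exact: mzv_spanZ | rewrite mulrCA]. Qed.

Lemma zeta2_multiple_even i : zeta2_multiple (zeta R [:: i.+1.*2]).
Proof.
elim/ltn_ind: i => -[|m] IH; first by exists 1; rewrite ?mulr1 //; exact: mzv_span1 Zsh_reg.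
have -> : zeta R [:: m.+2.*2] = ratr ((m%:R + 5 / 2)^-1) *
    \sum_(a < m.+1) zeta R [:: a.+1.*2] * zeta R [:: (m - a).+1.*2].
  rewrite -euler_even_zeta fmorphV rmorphD rmorph_nat fmorph_div !rmorph_nat mulKf //.
apply/zeta2_multipleZ/zeta2_multiple_sum => a _.
by apply: zeta2_multipleM; [exact: IH | exact: mzv_span_even].
Qed.

(** For i > 0, Newton's identity in the limit gives a rational combination of even zeta values, all
    multiples of zeta(2), times limits for smaller i, which lie in the span. *)
Lemma cvg_hstar_twos i : exists2 F : R, (fun N => hstar (nseq i 2%N) N) @ \oo --> F &
  if i == 0%N then F = 1 else zeta2_multiple F.
Proof.
elim/ltn_ind: i => -[_|i IH]; first by exists 1 => //; exact: cvg_cst.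
have {IH}[F FP] : exists F : nat -> R, forall j, (j < i.+1)%N ->
    ((fun N => hstar (nseq j 2%N) N) @ \oo --> F j) /\ mzv_span (F j).
  have H j : exists Fj : R, (j < i.+1)%N ->
      ((fun N => hstar (nseq j 2%N) N) @ \oo --> Fj) /\ mzv_span Fj.
    case: (ltnP j i.+1) => [ji|]; last by exists 0.
    have [Fj cvFj FjP] := IH j ji; exists Fj => _; split=> //.
    case: (j == 0%N) FjP => [->|[c cP ->]]; first exact: mzv_span1 Zsh_reg.
    exact: mzv_spanM Zsh_reg _ _ (mzv_span_even 0) cP.
  by exists (fun j => projT1 (cid (H j))) => j; exact: projT2 (cid (H j)).
exists (i.+1%:R^-1 * \sum_(a < i.+1) zeta R [:: a.+1.*2] * F (i.+1 - a.+1)%N).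
  apply: cvg_divl; first by rewrite pnatr_eq0.
  under eq_fun do rewrite -newton_hstar.
  apply: cvg_sum_ord => a; apply: cvgM; first exact: cvg_psum.
  by apply: (FP _ _).1; rewrite ltnS leq_subr.
rewrite /=; have -> : i.+1%:R^-1 = ratr (i.+1%:R^-1 : rat) :> R by rewrite fmorphV rmorph_nat.
apply/zeta2_multipleZ/zeta2_multiple_sum => a _.
apply: zeta2_multipleM; first exact: zeta2_multiple_even.
by apply: (FP _ _).2; rewrite subSS ltnS leq_subr.
Qed.

Lemma cvg_hsin m : exists2 F : R, (fun N => hsin N m) @ \oo --> F &
  if m == 0%N then F = 1 else zeta2_multiple F.
Proof.
rewrite -(odd_double_half m); case: (odd m); rewrite ?add0n ?add1n.
  exists 0; last by exists 0; rewrite ?mulr0 //; exact: mzv_span0.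
  by under eq_fun do rewrite (hsin_even _ _).2; exact: cvg_cst.
have [F cvF FP] := cvg_hstar_twos m./2; exists F; last by rewrite double_eq0.
by under eq_fun do rewrite (hsin_even _ _).1.
Qed.

End EvenZeta.

(** * The comparison *)

(** The limit identities are available on genuine indices; suffixes of an index are indices, so the
    induction of [conv_injl] carries over. *)
Lemma conv_injl_index (R : comPzRingType) (f g g' : seq nat -> R) l :
    f [::] = 1 -> (forall t, is_index t -> conv f g t = conv f g' t) ->
  is_index l -> g l = g' l.
Proof.
move=> f1 eqc; have [m] := ubnP (size l); elim: m l => // m IHm l szl lP.
have := eqc l lP; rewrite !conv_sum !big_ord_recl /= take0 f1 !drop0 !mul1r.
rewrite [X in _ + X = _](_ : _ = \sum_(i < size l) f (take (bump 0 i) l) * g' (drop (bump 0 i) l)).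
  exact: addIr.
apply: eq_bigr => i _; congr (_ * _); apply: IHm.
  by rewrite size_drop /bump; have := ltn_ord i; move: szl; lia.
by apply/allP => a /mem_drop; exact: (allP lP).
Qed.

Section StarLimit.
Variable R : realType.
Implicit Types G : seq nat -> R.

Lemma cvg_merge_sum (u : nat -> seq nat -> R) G a t : (0 < a)%N -> is_index t ->
    (forall l, is_index l -> (fun N => u N l) @ \oo --> G l) ->
  (fun N => merge_sum (u N) a t) @ \oo --> merge_sum G a t.
Proof.
elim: t a u G => [|b t IHt] a u G a0 tP uG; first by apply: uG; rewrite /= a0.
case/andP: tP => b0 tP; apply: cvgD; apply: IHt => //; first by rewrite addn_gt0 a0.
by move=> l lP; apply: uG; rewrite /= a0.
Qed.

Lemma cvg_star_sum (u : nat -> seq nat -> R) G l : is_index l ->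
    (forall l, is_index l -> (fun N => u N l) @ \oo --> G l) ->
  (fun N => star_sum (u N) l) @ \oo --> star_sum G l.
Proof.
case: l => [|a t] lP uG; first exact: uG.
by case/andP: lP => a0 tP; exact: cvg_merge_sum.
Qed.

End StarLimit.

Section Main.
Variables (R : realType) (Zsh : hoffman -> {poly R}).
Hypothesis Zsh_reg : is_shuffle_regularization Zsh.
Local Notation s := (fun l => phi Zsh (rword l)).

Lemma zeta_star_sh_sum k : zeta_star_sh Zsh k = star_sum s (rev k).
Proof.
have -> : star_sum s (rev k) = star_sum (zeta_sh Zsh) k.
  rewrite -(star_sum_rev (zeta_sh Zsh)).
  by congr star_sum; apply/funext => l; rewrite zeta_sh_rev.
case: k => [|a t]; last exact: merge_sum_tuple.
by have := zeta_sh_rev Zsh [::]; rewrite /= => ->; rewrite (phi_nil Zsh_reg).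
Qed.

Lemma signed_star_conv : exists F : nat -> R,
  [/\ F 0%N = 1, forall m, zeta2_multiple (F m.+1) &
   forall k, is_index k -> signed (zeta_star_sh Zsh) k =
     conv (signed (star_value (phi Zsh))) (ones F) k].
Proof.
pose F m := projT1 (cid2 (cvg_hsin Zsh_reg m)).
have Fcvg m : (fun N => hsin R N m) @ \oo --> F m by rewrite /F; case: cid2.
have FP m : if m == 0%N then F m = 1 else zeta2_multiple (F m) by rewrite /F; case: cid2.
exists F; split=> [|m|k kP]; [exact: (FP 0%N) | exact: (FP m.+1) |].
(* Convolved with [s] on the left, the left side is the limit of [conv_hreg_star], and the right
   side is [ones F] by [conv_star_value]. *)
apply: (@conv_injl_index _ s) kP => [|l lP]; first exact: phi_nil.
transitivity (ones F l); last first.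
  rewrite -convA -[LHS]conv1l; apply: eq_conv => // u; apply/esym.
  exact: (conv_star_value (phi_nil Zsh_reg)).
have L : (fun N => ones (hsin R N) l) @ \oo -->
    conv s (signed (zeta_star_sh Zsh)) l.
  rewrite conv_sum; apply: (@cvg_eqfun _ (fun N => \sum_(i < (size l).+1)
      hreg R N (take i l) * signed (fun k => star_sum (hreg R N) (rev k)) (drop i l))).
    by move=> N; rewrite -conv_hreg_star // conv_sum.
  have iP j : is_index (take j l) /\ is_index (drop j l).
    by split; apply/allP => a; [move/mem_take | move/mem_drop]; exact: (allP lP).
  apply: cvg_sum_ord => i; apply: cvgM; first by apply: (cvg_hreg Zsh_reg); exact: (iP i).1.
  rewrite /signed zeta_star_sh_sum; apply: cvg_mull; apply: cvg_star_sum.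
    by rewrite /is_index all_rev; exact: (iP i).2.
  by move=> u; exact: cvg_hreg.
apply: (norm_cvg_unique L); rewrite /ones; case: ifP => _; first exact: Fcvg.
exact: cvg_cst.
Qed.

End Main.

Unset Implicit Arguments.

Theorem theorem2p1 (R : realType) (Zsh : hoffman -> {poly R})
    (hZsh : is_shuffle_regularization Zsh) (k : seq nat) (hk : is_index k) :
  exists2 c : R, mzv_span c &
    zeta_star_sh Zsh k - zeta_star_KY Zsh k = zeta R [:: 2%N] * c.
Proof.
have [F [F0 FZ /(_ k hk) E]] := signed_star_conv hZsh.
rewrite -/(zeta2_multiple _) zeta_star_KYE //.
have sgnZ x : zeta2_multiple x -> zeta2_multiple ((-1) ^+ size k * x).
  by move/(zeta2_multipleZ ((-1) ^+ size k)); rewrite rmorphXn rmorphN1.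
rewrite -[_ - _](signrMK (size k)) mulrBr; apply: sgnZ.
rewrite -/(signed (zeta_star_sh Zsh) k) E conv_sum big_ord_recr /=.
(* The split with empty suffix has coefficient F 0 = 1 and cancels the Kaneko-Yamamoto value. Every
   other split carries either 0 or some F m with m > 0. *)
rewrite take_size drop_size /ones /= F0 mulr1 addrK.
apply: zeta2_multiple_sum => i _; rewrite mulrC; apply: (zeta2_multipleM hZsh).
  case: ifP => _; last by exists 0; rewrite ?mulr0 //; exact: mzv_span0.
  by rewrite size_drop -[(size k - i)%N]prednK ?subn_gt0 ?ltn_ord //; exact: FZ.
have /(mzv_spanZ ((-1) ^+ size (take i k))) := star_value_span hZsh (take i k).
by rewrite rmorphXn rmorphN1.
Qed.
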